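(* Let $R$ be a ring and $\mathcal D$ a deconstructible class of right $R$-modules. Then either there is a cardinal $\theta$ such that $\mathcal D$ is not $\lambda$-categorical for any cardinal $\lambda>\theta$, or there is a cardinal $\theta'$ such that $\mathcal D$ is $\lambda$-categorical for every cardinal $\lambda\geq\theta'$. In other words, categoricity of $\mathcal D$ in a sufficiently big cardinal is equivalent to its categoricity in a tail of cardinals.
   Context: For a class $\mathcal C$ of modules, a $\mathcal C$-filtration of a module $M$ is an increasing chain of submodules $(M_\alpha\mid\alpha<\sigma)$ with $M_0=0$, $M=\bigcup_{\alpha<\sigma}M_\alpha$, $M_\alpha=\bigcup_{\beta<\alpha}M_\beta$ for limit $\alpha$, and each $M_{\alpha+1}/M_\alpha$ isomorphic to a member of $\mathcal C$; $\mathrm{Filt}(\mathcal C)$ is the class of modules possessing a $\mathcal C$-filtration. A class $\mathcal D$ is $\kappa$-deconstructible ($\kappa$ infinite cardinal) if there is a subset $\mathcal C\subseteq\mathcal D$ consisting of $<\kappa$-presented modules with $\mathcal D=\mathrm{Filt}(\mathcal C)$; deconstructible means $\kappa$-deconstructible for some $\kappa$. $\mathcal D$ is $\lambda$-categorical if it contains a module of cardinality $\lambda$ and all its modules of cardinality $\lambda$ are isomorphic. *)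

(* Defs.v *)
From HB Require Import structures.
From mathcomp Require Import all_boot all_algebra ring_quotient finmap.
From mathcomp Require Import boolp classical_sets cardinality wochoice.

Set Implicit Arguments.
Unset Strict Implicit.
Unset Printing Implicit Defensive.

Import GRing.Theory.

Local Open Scope classical_set_scope.
Local Open Scope ring_scope.
Local Open Scope quotient_scope.

(* A right R-module is a left module over the converse ring: for M : rmodType R,
   a *: v is the product of v by a on the right. *)
Notation rmodType R := (lmodType R^c).

(* Cardinals are represented by choiceTypes. The carriers of choiceTypes and of
   modules live in the same universe (MathComp equates the two levels), so the
   cardinals quantified over are exactly the cardinals of small sets: none of
   them exceeds the size of all modules. For the same reason a family of modules
   indexed by a choiceType is a set of modules, as opposed to a proper class,
   and a well-ordered choiceType is an ordinal. *)
Definition card_lt (T U : Type) (A : set T) (B : set U) : Prop :=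
  (A #<= B)%card /\ (A #!= B)%card.

Section SubModule.
Variables (A : pzRingType) (M : lmodType A).
Implicit Types S T : submodClosed M.

Record submodule S : predArgType :=
  Submodule { submodule_val : M; _ : submodule_val \in S }.

HB.instance Definition _ S := [isSub for @submodule_val S].
HB.instance Definition _ S := [Choice of submodule S by <:].
HB.instance Definition _ S := [SubChoice_isSubLmodule of submodule S by <:].

(* The trace of T on S, as a predicate on S; it is T itself when T is contained
   in S. *)
Definition trace S T : {pred submodule S} := fun x => val x \in T.
Arguments trace : clear implicits.

Fact trace_submod_closed S T : submod_closed (trace S T).
Proof.
split=> [|a u v Tu Tv]; first exact: rpred0.
by rewrite /trace unfold_in linearP rpredD ?rpredZ.
Qed.

HB.instance Definition _ S T :=
  GRing.isSubmodClosed.Build A (submodule S) (trace S T)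
    (trace_submod_closed S T).

End SubModule.
Arguments trace {A M} S T.

(* The quotient group is MathComp's Quotient.quot. It asks for a zmodClosed, which
   is not inferred from submodClosed, hence the alias zmod_of; the scaling is
   added below. *)
Section QuotientModule.
Variables (A : pzRingType) (M : lmodType A) (S : submodClosed M).

Definition zmod_of : {pred M} := fun x => x \in S.

HB.instance Definition _ := GRing.isZmodClosed.Build M zmod_of
  (GRing.submod_closedB (submodClosedP S)).

Definition quotient_module : Type := Quotient.quot zmod_of.

HB.instance Definition _ := GRing.Zmodule.on quotient_module.

Definition quotient_proj (v : M) : quotient_module := \pi_(Quotient.quot zmod_of) v.

Definition quotient_repr (x : quotient_module) : M :=
  repr (x : Quotient.quot zmod_of).

Definition quotient_scale (a : A) (x : quotient_module) : quotient_module :=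
  quotient_proj (a *: quotient_repr x).

Fact quotient_reprK : cancel quotient_repr quotient_proj.
Proof. exact: reprK. Qed.

Fact quotient_proj_eq v w : (quotient_proj v == quotient_proj w) = (v - w \in S).
Proof. by rewrite -Quotient.idealrBE. Qed.

Fact quotient_projD v w :
  quotient_proj (v + w) = quotient_proj v + quotient_proj w.
Proof. exact: Quotient.pi_add. Qed.

Fact quotient_projZ a v : quotient_proj (a *: v) = quotient_scale a (quotient_proj v).
Proof.
apply/eqP; rewrite quotient_proj_eq -scalerBr rpredZ //.
by rewrite -quotient_proj_eq quotient_reprK.
Qed.

Fact quotient_scaleA a b x :
  quotient_scale a (quotient_scale b x) = quotient_scale (a * b) x.
Proof. by rewrite -quotient_projZ scalerA. Qed.

Fact quotient_scale1 : left_id 1 quotient_scale.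
Proof. by move=> x; rewrite /quotient_scale scale1r quotient_reprK. Qed.

Fact quotient_scaleDr : right_distributive quotient_scale +%R.
Proof.
move=> a x y; rewrite -[x]quotient_reprK -[y]quotient_reprK.
by rewrite -quotient_projD -!quotient_projZ scalerDr quotient_projD.
Qed.

Fact quotient_scaleDl x : {morph quotient_scale^~ x : a b / a + b}.
Proof. by move=> a b; rewrite /quotient_scale scalerDl quotient_projD. Qed.

HB.instance Definition _ :=
  GRing.Zmodule_isLmodule.Build A quotient_module
    quotient_scaleA quotient_scale1 quotient_scaleDr quotient_scaleDl.

End QuotientModule.

Definition isomorphic (A : pzRingType) (M N : lmodType A) : Prop :=
  exists f : {linear M -> N}, bijective f.

(* T / S; only used when S is contained in T. *)
Definition subquotient (A : pzRingType) (M : lmodType A) (T S : submodClosed M) :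
  lmodType A := quotient_module (trace T S).

Section Presented.
Variables (A : pzRingType).

(* F is free with basis (b x)_x; finsupp c is the finite set where c is nonzero. *)
Definition is_basis (X : choiceType) (F : lmodType A) (b : X -> F) : Prop :=
  forall v : F, exists! c : {fsfun X -> A with 0},
    v = \sum_(x <- finsupp c) c x *: b x.

Definition generated (M : lmodType A) (G : set M) : set M :=
  smallest (fun U : set M => submod_closed (mem U)) G.

(* M is the quotient of a free module of rank < kappa by a submodule generated by
   fewer than kappa elements. *)
Definition lt_presented (kappa : choiceType) (M : lmodType A) : Prop :=
  exists (X : choiceType) (F : lmodType A) (b : X -> F) (f : {linear F -> M})
         (G : set F),
    [/\ card_lt [set: X] [set: kappa] /\ is_basis b,
        (forall y : M, exists x : F, f x = y),
        card_lt G [set: kappa] &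
        [set x | f x = 0] = generated G].

End Presented.

Section WellOrderedIndex.
Variables (I : Type) (le : rel I).

Definition is_least (i : I) : Prop := forall k, le i k.

Definition is_succ (i j : I) : Prop :=
  [/\ le i j, i <> j & forall k, le i k -> i <> k -> le j k].

Definition is_limit (j : I) : Prop :=
  ~ is_least j /\ ~ (exists i, is_succ i j).

End WellOrderedIndex.

Section Filtration.
Variables (A : pzRingType).
Implicit Types C D : lmodType A -> Prop.

(* The well-ordered type (sigma, le) stands for the length of the chain. *)
Definition is_filtration C (M : lmodType A) (sigma : choiceType) (le : rel sigma)
    (F : sigma -> submodClosed M) : Prop :=
  [/\ (forall i j, le i j -> {subset F i <= F j}),
      (forall i, is_least le i -> F i =i pred1 0),
      (forall x : M, exists i, x \in F i),
      (forall j, is_limit le j ->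
         forall x : M, x \in F j <-> exists i, [/\ le i j, i <> j & x \in F i]) &
      (forall i j, is_succ le i j ->
         exists2 N, C N & isomorphic (subquotient (F j) (F i)) N)].

Definition Filt C (M : lmodType A) : Prop :=
  exists (sigma : choiceType) (le : rel sigma) (F : sigma -> submodClosed M),
    well_order le /\ is_filtration C le F.

Definition kappa_deconstructible (kappa : choiceType) D : Prop :=
  exists (J : choiceType) (C : J -> lmodType A),
    [/\ (forall j, D (C j)),
        (forall j, lt_presented kappa (C j)) &
        forall M, D M <-> Filt (fun N => exists j, N = C j) M].

Definition deconstructible D : Prop :=
  exists kappa : choiceType,
    infinite_set [set: kappa] /\ kappa_deconstructible kappa D.

Definition categorical (lambda : choiceType) D : Prop :=
  (exists M, D M /\ [set: M] #= [set: lambda])%card /\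
  (forall M N, D M -> D N -> ([set: M] #= [set: lambda])%card ->
     ([set: N] #= [set: lambda])%card -> isomorphic M N).

End Filtration.

(* Main.v *)
(* A categorical class absorbs summands, so a chain of non-split extensions of
   length lambda^+ cannot exist. In detail, let D = Filt(C) be categorical in
   lambda and in lambda1 > lambda, both large, and let P be its member of size
   lambda. Suppose that P has a non-split extension by some N in C. As every
   member of D of size lambda is isomorphic to P, one can iterate: there is a
   continuous chain of length lambda^+, with all factors N, all of whose steps
   from a stage of size lambda are non-split. Padded with copies of N to size
   lambda1, its union is isomorphic to a direct sum of copies of N, and closing
   off under this isomorphism produces a stage of size lambda which is a retract
   of the union: a contradiction. So Ext^1(N, P) = 0, and since N is small this
   makes every C-filtration split. Every member of D is thus a direct sum of
   members of C; in size lambda' >= lambda1, grouping the summands into blocks of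
   size lambda shows that it is isomorphic to a direct sum of lambda' copies of
   P. Categoricity in every lambda' >= lambda1 follows. *)

From HB Require Import structures.
Require Import Defs.
From mathcomp Require Import all_boot all_algebra.
From mathcomp Require Import boolp classical_sets functions cardinality wochoice.

Set Implicit Arguments.
Unset Strict Implicit.
Unset Printing Implicit Defensive.

Import GRing.Theory.

Local Open Scope classical_set_scope.
Local Open Scope card_scope.
Local Open Scope ring_scope.

(** * Cardinals and well-orders *)

(** The long chain is not built by recursion on modules, which would need limits of modules and
    transport along isomorphisms. All its stages sit in one quotient of a fixed direct sum of copies
    of a free module, and only the set of relations is defined by transfinite recursion. Nor is a
    stage identified with [P] during the construction: each early step attaches a non-split
    extension whenever one exists. The isomorphism with [P] is needed only at the stage that ends up
    a retract, to show that a non-split choice was available there. The retraction then extends the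
    attaching map of that very step, which is what splitting means. The split steps of the padding
    make the union of the earlier ones a summand of the whole, so that elements can be moved back
    from the direct sum into early stages. The module [P] is not fixed: for a given N it is any
    small sum of members of C, enlarged by lambda copies of N. *)

Lemma dependent_choice (X : Type) (Y : X -> Type) (P : forall x, Y x -> Prop) :
  (forall x, exists y, P x y) -> exists f : forall x, Y x, forall x, P x (f x).
Proof. by move=> h; exists (fun x => projT1 (cid (h x))) => x; apply: projT2 (cid (h x)). Qed.

Section Cardinals.
Implicit Types T U V : Type.

Lemma card_leTP T U :
  ([set: T] #<= [set: U]) <-> exists f : T -> U, injective f.
Proof.
split=> [|[f fI]].
  elim/Ppointed: U => U; last first.
    by move=> /pcard_leP[f]; exists f => x y; apply: inj; rewrite inE.
  rewrite (_ : [set: U] = set0); last by apply/seteqP; split=> // x; case: (no x).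
  rewrite card_le0 => /eqP T0.
  have noT (x : T) : False by have : [set: T] x by []; rewrite T0.
  by exists (fun x => False_rect _ (noT x)) => x; case: (noT x).
have : $|{injfun [set: T] >-> [set: U]}|.
  by apply/injfunPex; exists f => // x y _ _; apply: fI.
by case=> g; apply: inj_card_le.
Qed.

Lemma card_le_injfun T U (A : set T) (B : set U) (u0 : U) :
  A #<= B -> exists2 f : T -> U, set_fun A B f & set_inj A f.
Proof.
elim/Ppointed: U u0 B => U u0 B; first by case: (no u0).
by move=> /pcard_leP le; apply/injfunPex.
Qed.

Lemma card_leSP T U (D : set T) (u0 : U) :
  (D #<= [set: U]) <-> exists f : T -> U, set_inj D f.
Proof.
split=> [|[f fI]].
  by move=> /(card_le_injfun u0)[f _ fI]; exists f.
have : $|{injfun D >-> [set: U]}| by apply/injfunPex; exists f.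
by case=> g; apply: inj_card_le.
Qed.

Lemma card_le_surj T U (f : T -> U) (D : set T) (E : set U) :
  (forall y, E y -> exists2 x, D x & f x = y) -> E #<= D.
Proof. by move=> fE; apply: card_le_trans (card_image_le f D); apply: subset_card_le. Qed.

(** Zorn's lemma for graphs of partial injections: if a maximal graph is not defined at [a0], then
    it is onto, since a missed [b] would allow adding the pair of [a0] and [b]. *)
Lemma card_le_totalT T U : ([set: T] #<= [set: U]) \/ ([set: U] #<= [set: T]).
Proof.
pose P (G : set (T * U)) :=
  (forall a b b', G (a, b) -> G (a, b') -> b = b') /\
  (forall a a' b, G (a, b) -> G (a', b) -> a = a').
have [F FP tot|G [[Gf Gi] Gmax]] := @Zorn_bigcup _ P.
  have common x y : (\bigcup_(X in F) X) x -> (\bigcup_(X in F) X) y ->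
      exists X, [/\ F X, X x & X y].
    move=> [X FX Xx] [Y FY Yy].
    by have [XY|YX] := tot X Y FX FY; [exists Y|exists X]; split=> //; auto.
  split=> [a b b'|a a' b] /common h /h[X [/FP[Xf Xi]]]; [exact: Xf|exact: Xi].
have [dom|/existsNP[a0 Na0]] := pselect (forall a, exists b, G (a, b)).
  by left; apply/card_leTP; have [f fG] := choice dom; exists f => x y e;
    apply: Gi (fG x) _; rewrite e.
right; apply/card_leTP.
have ran b : exists a, G (a, b).
  apply: contrapT => Nb; apply: (Gmax (G `|` [set (a0, b)])).
    split=> [x Gx|sub]; first by left.
    by apply: Na0; exists b; apply: sub; right.
  have N1 c : ~ G (a0, c) by move=> ?; apply: Na0; exists c.
  have N2 a : ~ G (a, b) by move=> ?; apply: Nb; exists a.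
  split=> [a c c'|a a' c].
    move=> [Gc|/pair_equal_spec[ea ec]] [Gc'|/pair_equal_spec[ea' ec']].
    - exact: Gf Gc Gc'.
    - by case: (N1 c); rewrite -ea'.
    - by case: (N1 c'); rewrite -ea.
    - by rewrite ec.
  move=> [Gc|/pair_equal_spec[ea ec]] [Gc'|/pair_equal_spec[ea' ec']].
  - exact: Gi Gc Gc'.
  - by case: (N2 a); rewrite -ec'.
  - by case: (N2 a'); rewrite -ec.
  - by rewrite ea.
by have [f fG] := choice ran; exists f => x y e; apply: Gf (fG x) _; rewrite e.
Qed.

Lemma card_le_total T U (A : set T) (B : set U) : (A #<= B) \/ (B #<= A).
Proof.
have := card_le_totalT A B.
by rewrite (card_le_eql (card_setT A)) (card_le_eql (card_setT B))
  (card_le_eqr (card_setT A)) (card_le_eqr (card_setT B)).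
Qed.

End Cardinals.

(** * An infinite set has the cardinality of its square *)

Section Square.
Variable T : Type.
Implicit Type G : set (T * T * T).

(** The domain of a pairing is recovered from the diagonal of its graph, so that pairings can be
    ordered by inclusion of graphs alone. *)
Definition diag_dom G : set T := [set a | exists c, G (a, a, c)].

Definition is_pairing G : Prop :=
  [/\ forall a b c c', G (a, b, c) -> G (a, b, c') -> c = c',
      forall a b a' b' c, G (a, b, c) -> G (a', b', c) -> a = a' /\ b = b',
      forall a b c, G (a, b, c) -> [/\ diag_dom G a, diag_dom G b & diag_dom G c] &
      forall a b, diag_dom G a -> diag_dom G b -> exists c, G (a, b, c)].

Definition pairing_graph (D : set T) (F : T -> T -> T) : set (T * T * T) :=
  [set p | [/\ D p.1.1, D p.1.2 & p.2 = F p.1.1 p.1.2]].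

Lemma pairing_graphP D F :
  (forall a b, D a -> D b -> D (F a b)) ->
  (forall a b a' b', D a -> D b -> D a' -> D b' -> F a b = F a' b' ->
     a = a' /\ b = b') ->
  is_pairing (pairing_graph D F).
Proof.
move=> FD FI; have dom a : D a -> diag_dom (pairing_graph D F) a.
  by move=> Da; exists (F a a).
split.
- by move=> a b c c' [/= _ _ ->] [/= _ _ ->].
- by move=> a b a' b' c [/= Da Db ->] [/= Da' Db' e]; apply: FI.
- by move=> a b c [/= Da Db ->]; split; apply: dom => //; apply: FD.
- by move=> a b [c [/= Da _ _]] [c' [/= Db _ _]]; exists (F a b).
Qed.

Hypothesis Tinf : infinite_set [set: T].

(** A maximal pairing lives on some [S]. If the complement of [S] injects into [S], then all of [T]
    does, and the pairing of [S] serves for [T]. Otherwise [S] has a disjoint copy, onto which the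
    pairing extends, against maximality. *)
Lemma card_le_square : [set: T * T] #<= [set: T].
Proof.
move: Tinf => /infiniteP/card_leTP[i iI].
have [j ij] : exists j : T -> nat, cancel i j.
  have /choice[j jP] : forall t, exists n, (exists m, i m = t) -> i n = t.
    move=> t; have [[n e]|N] := pselect (exists m, i m = t); first by exists n.
    by exists 0%N => /N.
  by exists j => n; apply: iI; apply: jP; exists n.
pose F0 a b := i (pickle (j a, j b)).
pose G0 := pairing_graph (range i) F0.
have G0P : is_pairing G0.
  apply: pairing_graphP => [a b _ _|a b a' b']; first by exists (pickle (j a, j b)).
  move=> [m _ <-] [n _ <-] [m' _ <-] [n' _ <-] /iI.
  by move=> /(pcan_inj (@pickleK _)); rewrite !ij => -[-> ->].
(* The union with the countable pairing [G0] settles the empty chain, whose union is empty, and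
   provides infinitely many tags in [S]. *)
have [F FP tot|G [GP Gmax]] := @Zorn_bigcup _ (fun G => is_pairing (G `|` G0)).
  have [[X0 FX0]|F0'] := pselect (exists X, F X); last first.
    suff -> : \bigcup_(X in F) X = set0 by rewrite set0U.
    by apply/seteqP; split=> // x [X FX]; case: F0'; exists X.
  have one x : ((\bigcup_(X in F) X) `|` G0) x -> exists2 X, F X & (X `|` G0) x.
    by move=> [[X FX Xx]|G0x]; [exists X => //; left|exists X0 => //; right].
  have two x y : ((\bigcup_(X in F) X) `|` G0) x -> ((\bigcup_(X in F) X) `|` G0) y ->
      exists X, [/\ F X, (X `|` G0) x & (X `|` G0) y].
    move=> /one[X FX Xx] /one[Y FY Yy].
    have [XY|YX] := tot X Y FX FY.
      by exists Y; split=> //; case: Xx => [/XY|]; [left|right].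
    by exists X; split=> //; case: Yy => [/YX|]; [left|right].
  have up X x : F X -> (X `|` G0) x -> ((\bigcup_(X in F) X) `|` G0) x.
    by move=> FX [Xx|]; [left; exists X|right].
  have upd X a : F X -> diag_dom (X `|` G0) a ->
      diag_dom ((\bigcup_(X in F) X) `|` G0) a.
    by move=> FX [c Xc]; exists c; apply: up FX Xc.
  split.
  - by move=> a b c c' /two h /h[X [/FP[+ _ _ _]]]; apply.
  - by move=> a b a' b' c /two h /h[X [/FP[_ + _ _]]]; apply.
  - move=> a b c /one[X FX]; have [_ _ h _] := FP _ FX.
    by move=> /h[? ? ?]; split; apply: (upd X).
  - move=> a b [c +] [d +] => /two h /h[X [FX Xa Xb]].
    have [_ _ _ h'] := FP _ FX.
    by have [e Xe] := h' a b (ex_intro _ c Xa) (ex_intro _ d Xb); exists e; apply: up FX Xe.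
set H := G `|` G0 in GP; pose S := diag_dom H.
have [Hf Hi HS SH] := GP.
have /choice[f fP] : forall p : T * T, exists c, S p.1 -> S p.2 -> H (p.1, p.2, c).
  move=> p; have [[s1 s2]|N] := pselect (S p.1 /\ S p.2).
    by have [c Hc] := SH _ _ s1 s2; exists c.
  by exists (i 0%N) => s1 s2; case: N.
have fS a b : S a -> S b -> S (f (a, b)).
  by move=> Sa Sb; have [_ _] := HS _ _ _ (fP (a, b) Sa Sb).
have fI a b a' b' : S a -> S b -> S a' -> S b' -> f (a, b) = f (a', b') ->
    a = a' /\ b = b'.
  move=> Sa Sb Sa' Sb' e; apply: (Hi _ _ _ _ (f (a, b))).
    exact: (fP (a, b)).
  by rewrite e; apply: (fP (a', b')).
have Si n : S (i n).
  by exists (F0 (i n) (i n)); right; split=> //=; exists n.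
pose s n := i n.
have sE m n : s m = s n -> m = n by apply: iI.
have [|] := card_le_total (~` S) S.
  move=> le.
  have : exists2 p : T -> T, set_fun (~` S) S p & set_inj (~` S) p.
    exact: card_le_injfun (i 0%N) le.
  move=> [p pS pI].
  (* The tags [s 0] and [s 1] keep the images of [S] and of its complement apart. *)
  pose c x := if `[<S x>] then f (s 0%N, x) else f (s 1%N, p x).
  have cS x : S (c x).
    by rewrite /c; case: asboolP => Sx; apply: fS => //; apply: pS.
  have cI : injective c.
    move=> x y; rewrite /c; case: asboolP => Sx; case: asboolP => Sy /fI[]//.
    - by apply: pS.
    - by move=> /sE.
    - by apply: pS.
    - by move=> /sE.
    - by apply: pS.
    - by apply: pS.
    - by move=> _ e; apply: pI => //; rewrite inE.
  apply/card_leTP; exists (fun q => f (c q.1, c q.2)) => -[a b] [a' b'] /=.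
  by move=> /fI[]// /cI -> /cI ->.
move=> le; exfalso.
have : exists2 p : T -> T, set_fun S (~` S) p & set_inj S p.
  exact: card_le_injfun (i 0%N) le.
move=> [p pS pI].
have /choice[d0 d0P] : forall x, exists y, (exists2 z, S z & p z = x) -> S y /\ p y = x.
  move=> x; have [[z Sz e]|N] := pselect (exists2 z, S z & p z = x); first by exists z.
  by exists x => /N.
have d0K z : S z -> d0 (p z) = z.
  move=> Sz; have [|Sd e] := d0P (p z); first by exists z.
  by apply: pI; rewrite ?inE.
pose d x := if `[<S x>] then x else d0 x.
pose S2 := S `|` p @` S.
have dS x : S2 x -> S (d x).
  rewrite /d; case: asboolP => // Sx [//|[z Sz <-]].
  by rewrite d0K.
pose t a b := s (`[<S a>] + (`[<S b>]).*2)%N.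
pose F a b := if `[<S a>] && `[<S b>] then f (a, b) else p (f (f (t a b, d a), d b)).
have St a b : S (t a b) by exact: Si.
have dI x y : S2 x -> S2 y -> `[<S x>] = `[<S y>] -> d x = d y -> x = y.
  move=> S2x S2y e; rewrite /d -e; case: asboolP => // Sx.
  have Sy : ~ S y by move/asboolP; rewrite -e => /asboolP.
  by case: S2x S2y => [//|[z Sz <-]] [//|[z' Sz' <-]]; rewrite !d0K// => ->.
have pN x : S x -> ~ S (p x) by move=> /pS.
have Fin a b : S2 a -> S2 b -> `[<S (F a b)>] = `[<S a>] && `[<S b>].
  move=> S2a S2b; rewrite /F; case: ifP.
    by move=> /andP[/asboolP Sa /asboolP Sb]; apply/asboolP/fS.
  by move=> _; apply/asboolPn/pN; apply: (fS); [apply: fS => //|]; apply: dS.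
pose G' := pairing_graph S2 F.
have HG' : H `<=` G'.
  move=> [[a b] c] Hc; have [Sa Sb Sc] := HS _ _ _ Hc.
  split; [by left|by left|]; rewrite /= /F !asboolT//=.
  by apply: Hf Hc _; apply: (fP (a, b)).
have G'0 : G' `|` G0 = G'.
  by apply/setUidPl; apply: subset_trans HG'; apply: subsetUr.
have [] := Gmax G'.
  split; first by apply: subset_trans HG'; apply: subsetUl.
  move=> G'G; have Sp : S2 (p (s 0%N)) by right; exists (s 0%N); rewrite /s.
  have : H (p (s 0%N), p (s 0%N), F (p (s 0%N)) (p (s 0%N))) by left; apply: G'G.
  by move=> /HS[Sps _ _]; apply: (pN (s 0%N)).
rewrite G'0; apply: pairing_graphP.
  move=> a b S2a S2b; rewrite /F; case: ifP.
    by move=> /andP[/asboolP Sa /asboolP Sb]; left; apply: fS.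
  move=> _; right; exists (f (f (t a b, d a), d b)) => //.
  by apply: (fS); [apply: fS => //|]; apply: dS.
move=> a b a' b' S2a S2b S2a' S2b' e.
have : `[<S (F a b)>] = `[<S (F a' b')>] by rewrite e.
rewrite !Fin//; move: e; rewrite /F => + e0; rewrite -e0.
case: ifP => [ab|Nab].
  have /andP[/asboolP Sa /asboolP Sb] := ab.
  move: e0; rewrite ab => /esym/andP[/asboolP Sa' /asboolP Sb'].
  exact: fI.
have Sdd x y : S2 x -> S2 y -> S (f (t x y, d x)) by move=> *; apply: fS => //; apply: dS.
move=> /pI; rewrite !inE => /(_ (fS _ _ (Sdd _ _ _ _) (dS _ _)) (fS _ _ (Sdd _ _ _ _) (dS _ _))).
move=> /(_ S2a S2b S2b S2a' S2b' S2b').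
move=> /fI[]; [exact: Sdd|exact: dS|exact: Sdd|exact: dS|].
move=> /fI[//||//||]; [exact: dS|exact: dS|].
rewrite /t => /sE et ea eb.
have [ea' eb'] : `[<S a>] = `[<S a'>] /\ `[<S b>] = `[<S b'>].
  by move: et; do 4 case: `[<_>].
by split; apply: dI.
Qed.

End Square.

(** * Unions, sums and finite sequences under an infinite cardinal *)

Section InfiniteCardinals.
Variable T : Type.
Hypothesis Tinf : infinite_set [set: T].

Lemma infinite_point : exists t : T, True.
Proof. by have [t _] := infinite_setN0 Tinf; exists t. Qed.

Lemma card_le_bigcup (I X : Type) (P : set I) (D : I -> set X) :
  P #<= [set: T] -> (forall i, P i -> D i #<= [set: T]) ->
  \bigcup_(i in P) D i #<= [set: T].
Proof.
have [t0 _] := infinite_point.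
move=> /(card_leSP _ t0)[p pI] DT.
have /choice[d dI] : forall i, exists f : X -> T, P i -> set_inj (D i) f.
  move=> i; have [Pi|N] := pselect (P i); last by exists (fun=> t0).
  by have /(card_leSP _ t0)[f fI] := DT _ Pi; exists f.
have /choice[ix ixP] : forall x, exists o : option I,
    (\bigcup_(i in P) D i) x -> exists i, [/\ o = Some i, P i & D i x].
  move=> x.
  have [[i Pi Di]|N] := pselect ((\bigcup_(i in P) D i) x).
    by exists (Some i) => _; exists i.
  by exists None => /N.
apply: card_le_trans (card_le_square Tinf); apply/(card_leSP _ (t0, t0)).
exists (fun x => if ix x is Some i then (p i, d i x) else (t0, t0)).
move=> x y; rewrite !inE => /ixP[i [-> Pi Di]] /ixP[j [-> Pj Dj]] [].
move=> /pI; rewrite !inE => /(_ Pi Pj) ij.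
by rewrite -ij in Dj *; move=> /(dI _ Pi); apply; rewrite inE.
Qed.

Lemma card_nat_le : [set: nat] #<= [set: T].
Proof. exact/infiniteP. Qed.

Lemma card_le_sigT (I : Type) (N : I -> Type) :
  [set: I] #<= [set: T] -> (forall i, [set: N i] #<= [set: T]) ->
  [set: {i & N i}] #<= [set: T].
Proof.
move=> IT NT; apply: card_le_trans (card_le_bigcup (P := [set: I])
  (D := fun i => range (existT N i)) IT _) => [|i _].
  by apply: subset_card_le => -[i n] _; exists i => //; exists n.
exact: card_le_trans (card_image_le _ _) (NT i).
Qed.

Lemma card_le_sum (U V : Type) : [set: U] #<= [set: T] -> [set: V] #<= [set: T] ->
  [set: U + V] #<= [set: T].
Proof.
move=> UT VT; apply: card_le_trans (card_le_bigcup (P := [set: bool])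
  (D := fun b => if b then range inl else range inr) _ _).
- apply: subset_card_le => -[u|v] _; first by exists true => //; exists u.
  by exists false => //; exists v.
- exact: card_le_trans (countableP _) card_nat_le.
- by case=> _; [apply: card_le_trans UT|apply: card_le_trans VT];
    apply: card_image_le.
Qed.

Lemma card_le_seq (U : Type) : [set: U] #<= [set: T] -> [set: seq U] #<= [set: T].
Proof.
move=> UT; have [t0 _] := infinite_point.
have [[u uI] [p pI]] := ((card_leTP _ _).1 UT, (card_leTP _ _).1 (card_le_square Tinf)).
have [n nI] := (card_leTP _ _).1 card_nat_le.
(* The code [t0] of the empty list may also be the code of a longer one, hence the length stored
   next to [enc]. *)
pose enc := foldr (fun x t => p (u x, t)) t0.
apply/card_leTP; exists (fun s => p (n (size s), enc s)) => s s' /pI[/nI es ee].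
elim: s s' es ee => [|x s IH] [|y s'] //= [es] /pI[/uI -> ee].
by rewrite (IH s').
Qed.

End InfiniteCardinals.

(** * Well-orders and their strict parts *)

Section WellFounded.
Variables (X : choiceType) (le : rel X).
Hypothesis wo : well_order le.

Definition strictly (x y : X) : Prop := le x y /\ x <> y.

Lemma wo_min (P : set X) : P !=set0 -> exists2 x, P x & forall y, P y -> le x y.
Proof.
move=> [x0 Px0]; have [|x [[xP xm] _]] := @wo (fun x => `[<P x>]).
  by exists x0; apply/asboolP.
by exists x => [|y Py]; [apply/asboolP|apply: xm; apply/asboolP].
Qed.

Lemma wo_refl x : le x x.
Proof. by have [|y -> h] := @wo_min [set x]; [exists x|apply: h]. Qed.

Lemma wo_total x y : le x y \/ le y x.
Proof.
have [|z [->|->] h] := @wo_min [set x; y]; first by exists x; left.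
  by left; apply: h; right.
by right; apply: h; left.
Qed.

Lemma wo_anti x y : le x y -> le y x -> x = y.
Proof.
(* Antisymmetry comes from the uniqueness of the minimum: both [x] and [y] are minima of the
   pair. *)
move=> xy yx; have [|z [_ zU]] := @wo [pred z | (z == x) || (z == y)].
  by exists x; rewrite inE eqxx.
transitivity z; [symmetry|]; apply: zU; split; rewrite ?inE ?eqxx ?orbT// => t.
  by rewrite inE => /orP[] /eqP -> //; apply: wo_refl.
by rewrite inE => /orP[] /eqP -> //; apply: wo_refl.
Qed.

Lemma wo_trans x y z : le x y -> le y z -> le x z.
Proof.
move=> xy yz; have [|t tP h] := @wo_min [set t | [\/ t = x, t = y | t = z]].
  by exists x; constructor.
have [hx hy hz] : [/\ le t x, le t y & le t z].
  by split; apply: h; [constructor|constructor 2|constructor 3].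
case: tP => tE; first by rewrite -tE.
- by rewrite tE in hx; rewrite (wo_anti xy hx).
- by rewrite tE in hy; rewrite -(wo_anti yz hy).
Qed.

Lemma strict_trans x y z : strictly x y -> strictly y z -> strictly x z.
Proof.
move=> [xy nxy] [yz nyz]; split; first exact: wo_trans xy yz.
by move=> e; subst z; apply: nxy; apply: wo_anti.
Qed.

Lemma strict_total x y : [\/ x = y, strictly x y | strictly y x].
Proof.
have [->|/eqP ne] := eqVneq x y; first by constructor.
by have [] := wo_total x y; [constructor 2|constructor 3]; split=> // /esym.
Qed.

Lemma strict_wf : well_founded strictly.
Proof.
move=> x; apply: contrapT => Nx.
have [|y Ny ym] := @wo_min [set x | ~ Acc strictly x]; first by exists x.
apply: Ny; split=> z [zy nzy]; apply: contrapT => Nz.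
by apply: nzy; apply: wo_anti => //; apply: ym.
Qed.

End WellFounded.

(** * Direct sums *)

Section LinearMaps.
Variables (A : pzRingType).
Implicit Types M N : lmodType A.

Definition linear_of M N (f : M -> N) (fL : linear f) : {linear M -> N} :=
  HB.pack f (GRing.isLinear.Build A M N *:%R f fL).

Lemma linear_ofE M N (f : M -> N) (fL : linear f) x : linear_of fL x = f x.
Proof. by []. Qed.

Lemma bij_linear_inverse M N : isomorphic M N ->
  exists (f : {linear M -> N}) (g : {linear N -> M}), cancel f g /\ cancel g f.
Proof.
move=> [f [g fK gK]]; have gL : linear g.
  by move=> a u v; rewrite -{1}[u]gK -{1}[v]gK -linearP fK.
by exists f, (linear_of gL).
Qed.

Lemma isomorphic_sym M N : isomorphic M N -> isomorphic N M.
Proof. by move=> /bij_linear_inverse[f [g [fK gK]]]; exists g; exists f. Qed.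

Lemma isomorphic_trans M N P : isomorphic M N -> isomorphic N P -> isomorphic M P.
Proof.
move=> [f fb] [g gb]; have hL : linear (g \o f) by move=> a u v /=; rewrite !linearP.
by exists (linear_of hL); apply: bij_comp.
Qed.

Lemma inj_surj_isomorphic M N (f : {linear M -> N}) :
  injective f -> (forall y, exists x, f x = y) -> isomorphic M N.
Proof.
by move=> fI /choice[g gK]; exists f; exists g => // x; apply: fI; rewrite gK.
Qed.

Definition is_submodule M (P : set M) : Prop :=
  P 0 /\ forall a u v, P u -> P v -> P (a *: u + v).

Lemma is_submoduleD M (P : set M) u v : is_submodule P -> P u -> P v -> P (u + v).
Proof. by move=> [_ h] Pu Pv; rewrite -[u]scale1r; apply: h. Qed.

Lemma is_submoduleZ M (P : set M) a u : is_submodule P -> P u -> P (a *: u).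
Proof. by move=> [h0 h] Pu; rewrite -[_ *: _]addr0; apply: h. Qed.

Lemma is_submoduleN M (P : set M) u : is_submodule P -> P u -> P (- u).
Proof. by move=> hP Pu; rewrite -scaleN1r; apply: is_submoduleZ. Qed.

Lemma is_submoduleB M (P : set M) u v : is_submodule P -> P u -> P v -> P (u - v).
Proof. by move=> hP Pu Pv; apply: is_submoduleD => //; apply: is_submoduleN. Qed.

Lemma is_submodule_sum M (P : set M) I (s : seq I) (F : I -> M) :
  is_submodule P -> (forall i, P (F i)) -> P (\sum_(i <- s) F i).
Proof.
by move=> hP PF; elim/big_ind: _ => [|u v|//]; [case: hP|apply: is_submoduleD].
Qed.

(** The proof is an argument so that the [submodClosed] structure can be inferred from the term. *)
Definition set_pred M (P : set M) (_ : is_submodule P) : {pred M} :=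
  fun x => `[<P x>].

Fact set_pred_closed M (P : set M) (hP : is_submodule P) :
  submod_closed (set_pred hP).
Proof.
by case: (hP) => h0 h; split=> [|a u v /asboolP Pu /asboolP Pv]; apply/asboolP;
  [|apply: h].
Qed.

HB.instance Definition _ M (P : set M) (hP : is_submodule P) :=
  GRing.isSubmodClosed.Build A M (set_pred hP) (set_pred_closed hP).

Lemma in_set_pred M (P : set M) (hP : is_submodule P) x : (x \in set_pred hP) = `[<P x>].
Proof. by []. Qed.

End LinearMaps.

Section DirectSum.
Variables (A : pzRingType) (I : choiceType) (N : I -> lmodType A).

(** Finiteness of the support is a mere existence statement, so that elements with equal coordinates
    are equal. *)
Record dsum := Dsum {
  dsum_fun :> forall i, N i;
  dsum_fin : exists s : seq I, forall i, i \notin s -> dsum_fun i = 0 }.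

Lemma dsum_ext (u v : dsum) : (forall i, u i = v i) -> u = v.
Proof.
case: u v => [u uf] [v vf] /= uv; have e : u = v by apply: functional_extensionality_dep.
by subst v; congr Dsum; apply: Prop_irrelevance.
Qed.

HB.instance Definition _ := gen_eqMixin dsum.
HB.instance Definition _ := gen_choiceMixin dsum.

Fact dsum0_fin : exists s : seq I, forall i, i \notin s -> (0 : N i) = 0.
Proof. by exists [::]. Qed.
Definition dsum0 := Dsum dsum0_fin.

Fact dsumN_fin (u : dsum) : exists s : seq I, forall i, i \notin s -> - u i = 0.
Proof. by have [s su] := dsum_fin u; exists s => i /su ->; rewrite oppr0. Qed.
Definition dsumN u := Dsum (dsumN_fin u).

Fact dsumD_fin (u v : dsum) : exists s : seq I, forall i, i \notin s -> u i + v i = 0.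
Proof.
have [[s su] [t tv]] := (dsum_fin u, dsum_fin v); exists (s ++ t) => i.
by rewrite mem_cat negb_or => /andP[/su -> /tv ->]; rewrite addr0.
Qed.
Definition dsumD u v := Dsum (dsumD_fin u v).

Fact dsumZ_fin a (u : dsum) : exists s : seq I, forall i, i \notin s -> a *: u i = 0.
Proof. by have [s su] := dsum_fin u; exists s => i /su ->; rewrite scaler0. Qed.
Definition dsumZ a u := Dsum (dsumZ_fin a u).

Fact dsum_addA : associative dsumD.
Proof. by move=> u v w; apply: dsum_ext => i /=; rewrite addrA. Qed.
Fact dsum_addC : commutative dsumD.
Proof. by move=> u v; apply: dsum_ext => i /=; rewrite addrC. Qed.
Fact dsum_add0 : left_id dsum0 dsumD.
Proof. by move=> u; apply: dsum_ext => i /=; rewrite add0r. Qed.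
Fact dsum_addN : left_inverse dsum0 dsumN dsumD.
Proof. by move=> u; apply: dsum_ext => i /=; rewrite addNr. Qed.

HB.instance Definition _ :=
  GRing.isZmodule.Build dsum dsum_addA dsum_addC dsum_add0 dsum_addN.

Fact dsum_scaleA a b (u : dsum) : dsumZ a (dsumZ b u) = dsumZ (a * b) u.
Proof. by apply: dsum_ext => i /=; rewrite scalerA. Qed.
Fact dsum_scale1 : left_id 1 dsumZ.
Proof. by move=> u; apply: dsum_ext => i /=; rewrite scale1r. Qed.
Fact dsum_scaleDr : right_distributive dsumZ +%R.
Proof. by move=> a u v; apply: dsum_ext => i /=; rewrite scalerDr. Qed.
Fact dsum_scaleDl u : {morph dsumZ^~ u : a b / a + b}.
Proof. by move=> a b; apply: dsum_ext => i /=; rewrite scalerDl. Qed.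

HB.instance Definition _ :=
  GRing.Zmodule_isLmodule.Build A dsum
    dsum_scaleA dsum_scale1 dsum_scaleDr dsum_scaleDl.

Lemma dsum_coord_linear i : linear (fun u : dsum => u i).
Proof. by []. Qed.
Definition dsum_coord i : {linear dsum -> N i} := linear_of (dsum_coord_linear i).

Lemma dsum_add_coord (u v : dsum) i : (u + v) i = u i + v i. Proof. by []. Qed.
Lemma dsum_opp_coord (u : dsum) i : (- u) i = - u i. Proof. by []. Qed.
Lemma dsum_scale_coord a (u : dsum) i : (a *: u) i = a *: u i. Proof. by []. Qed.
Lemma dsum_zero_coord i : (0 : dsum) i = 0. Proof. by []. Qed.
Definition coordE := (dsum_add_coord, dsum_opp_coord, dsum_scale_coord, dsum_zero_coord).

Definition single_fun i (c : N i) k : N k :=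
  if i =P k is ReflectT e then ecast k (N k) e c else 0.

Fact single_fin i (c : N i) :
  exists s : seq I, forall k, k \notin s -> single_fun c k = 0.
Proof.
exists [:: i] => k; rewrite inE /single_fun; case: eqP => // e /eqP[].
by [].
Qed.
Definition single_val i c := Dsum (@single_fin i c).

Lemma single_valE i (c : N i) : single_val c i = c.
Proof. by rewrite /= /single_fun; case: eqP => // e; rewrite eq_axiomK. Qed.

Lemma single_val0 i (c : N i) k : k <> i -> single_val c k = 0.
Proof. by move=> ki; rewrite /= /single_fun; case: eqP => // e; case: ki. Qed.

Fact single_linear i : linear (@single_val i).
Proof.
move=> a u v; apply: dsum_ext => k; have [->|/eqP ki] := eqVneq k i.
  by rewrite !coordE !single_valE.
by rewrite !coordE !single_val0// scaler0 addr0.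
Qed.
Definition dsum_single i : {linear N i -> dsum} := linear_of (@single_linear i).

Lemma singleE i (c : N i) : dsum_single i c i = c.
Proof. exact: single_valE. Qed.

Lemma single0 i (c : N i) k : k <> i -> dsum_single i c k = 0.
Proof. exact: single_val0. Qed.

Lemma dsum_sum_coord J (s : seq J) (F : J -> dsum) i :
  (\sum_(j <- s) F j) i = \sum_(j <- s) F j i.
Proof. exact: (linear_sum (dsum_coord i)). Qed.

(** The chosen list may be longer than the support; [dsum_lift_funE] shows that sums over it do not
    depend on this choice. *)
Definition supp_seq (u : dsum) : seq I := undup (xget [::] [set s | forall i, i \notin s -> u i = 0]).

Lemma supp_seqP (u : dsum) i : i \notin supp_seq u -> u i = 0.
Proof.
rewrite mem_undup; case: xgetP => [s _ h|N0]; first exact: h.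
by have [s su] := dsum_fin u; case: (N0 s).
Qed.

Lemma supp_seq_uniq u : uniq (supp_seq u).
Proof. exact: undup_uniq. Qed.

Lemma dsum_decomp (u : dsum) (s : seq I) : uniq s ->
  (forall i, i \notin s -> u i = 0) -> u = \sum_(i <- s) dsum_single i (u i).
Proof.
move=> us su; apply: dsum_ext => k; rewrite dsum_sum_coord.
have [ks|ks] := boolP (k \in s).
  rewrite (bigD1_seq k)// singleE big1 => [|i /eqP ik]; first by rewrite /= addr0.
  by rewrite single0// => e; apply: ik.
rewrite su// big1_seq// => i ins.
by rewrite single0// => e; move: ks; rewrite e; case/andP: ins => _ ->.
Qed.

Section Lift.
Variables (M : lmodType A) (h : forall i, {linear N i -> M}).

Definition dsum_lift_fun (u : dsum) : M := \sum_(i <- supp_seq u) h i (u i).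

Lemma dsum_lift_funE (u : dsum) (s : seq I) : uniq s ->
  (forall i, i \notin s -> u i = 0) -> dsum_lift_fun u = \sum_(i <- s) h i (u i).
Proof.
have key (t : seq I) : uniq t -> (forall i, i \notin t -> u i = 0) ->
    \sum_(i <- t) h i (u i) =
    \sum_(i <- [seq i <- t | `[<u i <> 0>]]) h i (u i).
  move=> _ _; rewrite big_filter [LHS](bigID (fun i => `[<u i <> 0>]))/=.
  rewrite [X in _ + X]big1 ?addr0// => i /asboolPn/contrapT ->.
  by rewrite linear0.
move=> us su; rewrite /dsum_lift_fun key ?supp_seq_uniq//; last exact: supp_seqP.
rewrite [RHS]key//; apply: perm_big; apply: uniq_perm; rewrite ?filter_uniq ?supp_seq_uniq//.
move=> i; rewrite !mem_filter; case: asboolP => //= ui.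
by apply/idP/idP => _; apply/negPn/negP => /[dup]; [move=> /su|move=> /supp_seqP].
Qed.

Fact dsum_lift_linear : linear dsum_lift_fun.
Proof.
move=> a u v; pose s := undup (supp_seq u ++ supp_seq v).
have us : uniq s by apply: undup_uniq.
have su i : i \notin s -> u i = 0.
  by rewrite mem_undup mem_cat negb_or => /andP[/supp_seqP].
have sv i : i \notin s -> v i = 0.
  by rewrite mem_undup mem_cat negb_or => /andP[_ /supp_seqP].
have suv i : i \notin s -> (a *: u + v) i = 0.
  by move=> ins; rewrite !coordE su// sv// scaler0 addr0.
rewrite !(dsum_lift_funE us)// scaler_sumr -big_split; apply: eq_bigr => i _.
by rewrite !coordE linearP.
Qed.
Definition dsum_lift : {linear dsum -> M} := linear_of dsum_lift_linear.

Lemma dsum_liftE (u : dsum) : dsum_lift u = \sum_(i <- supp_seq u) h i (u i).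
Proof. by []. Qed.

Lemma dsum_lift_single i (c : N i) : dsum_lift (dsum_single i c) = h i c.
Proof.
rewrite linear_ofE (@dsum_lift_funE _ [:: i])// ?big_seq1 ?singleE// => k.
by rewrite inE => /eqP ki; apply: single0.
Qed.

Lemma dsum_lift_in (P : set M) (u : dsum) :
  is_submodule P -> (forall i, u i <> 0 -> P (h i (u i))) -> P (dsum_lift u).
Proof.
move=> hP Ph; rewrite dsum_liftE; apply: is_submodule_sum => // i.
have [->|/eqP/Ph//] := eqVneq (u i) 0.
by rewrite linear0; case: hP.
Qed.

End Lift.

Lemma dsum_single_sum (u : dsum) : u = \sum_(i <- supp_seq u) dsum_single i (u i).
Proof. by apply: dsum_decomp; [exact: supp_seq_uniq|exact: supp_seqP]. Qed.

(** An element is the sum of a finite list of homogeneous terms, and such lists are counted by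
    [card_le_seq]. *)
Lemma card_le_dsum (T : Type) : infinite_set [set: T] ->
  [set: I] #<= [set: T] -> (forall i, [set: N i] #<= [set: T]) ->
  [set: dsum] #<= [set: T].
Proof.
move=> Tinf IT NT.
apply: card_le_trans (card_le_seq Tinf (card_le_sigT Tinf IT NT)).
apply: (@card_le_surj _ _ (fun s => \sum_(p <- s) dsum_single (tag p) (tagged p)) setT) => u _.
exists [seq Tagged N (u i) | i <- supp_seq u] => //.
by rewrite big_map [RHS]dsum_single_sum.
Qed.

End DirectSum.

(** * Filtrations indexed by a well-ordered set *)

Record wf_total_order (X : Type) (lt : X -> X -> Prop) : Prop := WfTotalOrder {
  wto_wf : well_founded lt;
  wto_trans : forall x y z, lt x y -> lt y z -> lt x z;
  wto_total : forall x y, [\/ x = y, lt x y | lt y x] }.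

Section WfTotalOrder.
Variables (X : choiceType) (lt : X -> X -> Prop).
Hypothesis ltO : wf_total_order lt.

Lemma wto_ind (P : X -> Prop) :
  (forall x, (forall y, lt y x -> P y) -> P x) -> forall x, P x.
Proof. exact: (well_founded_ind (wto_wf ltO)). Qed.

Lemma wto_irr x : ~ lt x x.
Proof. by move: x; apply: wto_ind => x IH xx; exact: (IH _ xx xx). Qed.

Lemma wto_least (P : set X) : P !=set0 ->
  exists2 x, P x & forall y, lt y x -> ~ P y.
Proof.
move=> [x0 Px0]; apply: contrapT => N.
suff h : forall x, ~ P x by apply: h Px0.
by apply: wto_ind => x IH Px; apply: N; exists x.
Qed.

Lemma wto_seq_max (P : X -> Prop) (s : seq X) :
  (exists2 x, x \in s & P x) ->
  exists2 m, P m & forall k, k \in s -> P k -> ~ lt m k.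
Proof.
elim: s => [[x]//|a s IH] [x xs Px].
have [[y ys Py]|N] := pselect (exists2 x, x \in s & P x); last first.
  have Pa : P a by move: xs; rewrite inE => /orP[/eqP <-//|xs]; case: N; exists x.
  exists a => // k; rewrite inE => /orP[/eqP ->|ks Pk _]; first by move=> _; apply: wto_irr.
  by apply: N; exists k.
have [|m Pm mM] := IH; first by exists y.
have [[Pa ma]|N] := pselect (P a /\ lt m a).
  exists a => // k; rewrite inE => /orP[/eqP ->|ks Pk ak]; first by move=> _; apply: wto_irr.
  exact: mM ks Pk (wto_trans ltO ma ak).
exists m => // k; rewrite inE => /orP[/eqP -> Pa ma|ks Pk]; first by apply: N.
exact: mM.
Qed.

(** The index [m] carries the leading term, on which the arguments along a chain operate. *)
Lemma wto_dsum_max (A : pzRingType) (N : X -> lmodType A) (u : dsum N) :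
  u <> 0 -> exists2 m, u m <> 0 & forall k, lt m k -> u k = 0.
Proof.
move=> u0; have [|m um mM] := @wto_seq_max (fun x => u x <> 0) (supp_seq u).
  apply: contrapT => N0; apply: u0; apply: dsum_ext => i.
  have [iu|/supp_seqP//] := boolP (i \in supp_seq u).
  by apply: contrapT => ui; apply: N0; exists i.
exists m => // k mk; apply: contrapT => uk.
have [ku|/supp_seqP//] := boolP (k \in supp_seq u).
exact: mM ku uk mk.
Qed.

End WfTotalOrder.

(** Zero is added by hand so that an empty [Z], as at the least index, gives the zero submodule. *)
Definition below (X : Type) (V : nmodType) (T : X -> set V) (Z : set X) : set V :=
  [set m | m = 0 \/ exists2 y, Z y & T y m].

Definition init_segment (X : Type) (lt : X -> X -> Prop) (x : X) : set X := [set y | lt y x].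

Lemma below_is_submodule (A : pzRingType) (X : Type) (lt : X -> X -> Prop)
    (M : lmodType A) (T : X -> set M) (Z : set X) :
  wf_total_order lt -> (forall x, Z x -> is_submodule (T x)) ->
  (forall x y, Z x -> Z y -> lt x y -> T x `<=` T y) -> is_submodule (below T Z).
Proof.
move=> ltO Tsub Tmono; have common x y : Z x -> Z y ->
    exists2 z, Z z & T x `<=` T z /\ T y `<=` T z.
  move=> Zx Zy; have [->|xy|yx] := wto_total ltO x y; first by exists y => //; split.
    by exists y => //; split=> //; apply: Tmono.
  by exists x => //; split=> //; apply: Tmono.
split=> [|a u v]; first by left.
move=> [->|[x Zx xu]] [->|[y Zy yv]].
- by left; rewrite scaler0 addr0.
- by right; exists y => //; rewrite scaler0 add0r.
- by right; exists x => //; rewrite addr0; apply: is_submoduleZ xu; apply: Tsub.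
- have [z Zz [xz yz]] := common x y Zx Zy; right; exists z => //.
  by have [_ h] := Tsub z Zz; apply: h; [apply: xz|apply: yz].
Qed.

Section Chain.
Variables (A : pzRingType) (X : choiceType) (lt : X -> X -> Prop).
Variables (N : X -> lmodType A) (M : lmodType A).
Implicit Types (T : X -> set M) (Z : set X).

(* [T x] is the term of index [x + 1] of the filtration, and [below T] of the
   initial segment of [x] its term of index [x]; limit steps need no condition. *)
Record filter_chain T (g : forall x, M -> N x) : Prop := Chain {
  chain_order : wf_total_order lt;
  chain_sub : forall x, is_submodule (T x);
  chain_mono : forall x y, lt x y -> T x `<=` T y;
  chain_cover : forall m, below T setT m;
  chain_linear : forall x a u v, T x u -> T x v ->
    g x (a *: u + v) = a *: g x u + g x v;
  chain_surj : forall x c, exists2 m, T x m & g x m = c;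
  chain_ker : forall x m, T x m -> (g x m = 0 <-> below T (init_segment lt x) m) }.

Variables (T : X -> set M) (g : forall x, M -> N x).
Hypothesis ch : filter_chain T g.

Let ltO := chain_order ch.

Lemma below_submodule Z : is_submodule (below T Z).
Proof.
apply: (below_is_submodule ltO) => [x _|x y _ _ xy]; first exact: chain_sub ch x.
exact: (chain_mono ch xy).
Qed.

Lemma below_segment x : below T (init_segment lt x) `<=` T x.
Proof.
move=> m [->|[y yx ym]]; first by have [] := chain_sub ch x.
exact: (chain_mono ch yx ym).
Qed.

Lemma chainB x u v : T x u -> T x v -> g x (u - v) = g x u - g x v.
Proof.
move=> xu xv; rewrite addrC -scaleN1r (chain_linear ch)//.
by rewrite scaleN1r addrC.
Qed.

(** A step with nonzero factor contains an element that lies in no earlier step; such elements are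
    distinct for distinct steps. *)
Lemma chain_card : (forall x, exists c : N x, c <> 0) -> [set: X] #<= [set: M].
Proof.
move=> Nn0.
have /choice[e eP] : forall x, exists m, T x m /\ g x m <> 0.
  by move=> x; have [c c0] := Nn0 x; have [m xm mc] := chain_surj ch c; exists m; rewrite mc.
apply/card_leTP; exists e => x y exy.
have [//|xy|yx] := wto_total ltO x y; exfalso.
  have [ye] := eP y; apply; apply/(chain_ker ch) => //.
  by right; exists x => //; rewrite -exy; case: (eP x).
have [xe] := eP x; apply; apply/(chain_ker ch) => //.
by right; exists y => //; rewrite exy; case: (eP y).
Qed.

End Chain.

Section DownType.
Variables (X : choiceType) (lt : X -> X -> Prop) (Z : set X).

Definition down_type : choiceType := {x : X | `[<Z x>]}.

Lemma down_typeP (x : down_type) : Z (val x).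
Proof. by case: x => x /= /asboolP. Qed.

Definition down_elt x (Zx : Z x) : down_type := exist _ x (asboolT Zx).

Lemma wto_sub : wf_total_order lt ->
  wf_total_order (fun x y : down_type => lt (val x) (val y)).
Proof.
move=> ltO; split.
- move=> x; have [y e] : exists y, val x = y by exists (val x).
  elim/(wto_ind ltO): y x e => y IH x e; split=> z zx.
  by apply: IH (erefl _); rewrite -e.
- by move=> x y z; apply: wto_trans ltO _ _ _.
- by move=> x y; have [/val_inj->|xy|yx] := wto_total ltO (val x) (val y);
    [constructor|constructor 2|constructor 3].
Qed.

Lemma card_down_type : [set: down_type] #<= Z.
Proof.
rewrite -(card_le_eqr (card_setT Z)); apply/card_leTP.
exists (fun x => SigSub (mem_set (down_typeP x))) => x y /(congr1 val) e.
exact: val_inj.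
Qed.

End DownType.

Section Reindexing.
Variables (A : pzRingType) (I : choiceType) (N : I -> lmodType A).
Variables (I' : choiceType) (f : I' -> I).
Hypothesis fI : injective f.

Fact pull_fin (u : dsum N) : exists t : seq I', forall x, x \notin t -> u (f x) = 0.
Proof.
have /choice[g gP] : forall i, exists o, forall x, f x = i -> o = Some x.
  move=> i; have [[x e]|N0] := pselect (exists x, f x = i).
    by exists (Some x) => y ey; congr Some; apply: fI; rewrite e.
  by exists None => x e; case: N0; exists x.
exists (pmap g (supp_seq u)) => x xt; apply: supp_seqP; apply: contra xt => xu.
by rewrite mem_pmap; apply/mapP; exists (f x) => //; rewrite (gP _ x).
Qed.

Fact pull_linear : linear (fun u => Dsum (pull_fin u)).
Proof. by move=> a u v; apply: dsum_ext. Qed.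

Definition dsum_pull : {linear dsum N -> dsum (fun x => N (f x))} := linear_of pull_linear.

Definition dsum_push : {linear dsum (fun x => N (f x)) -> dsum N} :=
  dsum_lift (fun x => dsum_single N (f x)).

Lemma pullE u x : dsum_pull u x = u (f x). Proof. by []. Qed.

Lemma push_in w x : dsum_push w (f x) = w x.
Proof.
transitivity ((\sum_(i <- supp_seq w) dsum_single _ i (w i)) x); last first.
  by rewrite -dsum_single_sum.
rewrite /dsum_push dsum_liftE !dsum_sum_coord.
apply: eq_bigr => y _; have [->|/eqP xy] := eqVneq x y; first by rewrite !singleE.
by rewrite !single0// => /fI.
Qed.

Lemma push_out w i : (forall x, f x <> i) -> dsum_push w i = 0.
Proof.
move=> fi; rewrite /dsum_push dsum_liftE dsum_sum_coord big1// => y _; apply: single0 => e.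
by apply: (fi y).
Qed.

Lemma pushK : cancel dsum_push dsum_pull.
Proof. by move=> w; apply: dsum_ext => x; rewrite pullE push_in. Qed.

End Reindexing.

Section DirectSumRestriction.
Variables (A : pzRingType) (I : choiceType) (N : I -> lmodType A) (B : set I).

Definition dsum_restrict : {linear dsum N -> dsum (fun x : down_type B => N (val x))} :=
  dsum_pull N val_inj.

Definition dsum_extend : {linear dsum (fun x : down_type B => N (val x)) -> dsum N} :=
  dsum_push N val.

Definition dsum_cut (u : dsum N) : dsum N := dsum_extend (dsum_restrict u).

Lemma cut_in u i : B i -> dsum_cut u i = u i.
Proof. by move=> Bi; apply: (push_in val_inj _ (down_elt Bi)). Qed.

Lemma cut_out u i : ~ B i -> dsum_cut u i = 0.
Proof. by move=> Bi; apply: push_out => x e; apply: Bi; rewrite -e; apply: down_typeP. Qed.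

Lemma cut_id (u : dsum N) : (forall i, ~ B i -> u i = 0) -> dsum_cut u = u.
Proof.
move=> uB; apply: dsum_ext => i; have [Bi|nBi] := pselect (B i); first exact: cut_in.
by rewrite cut_out// uB.
Qed.

Lemma cut_linear : linear dsum_cut.
Proof. by move=> a u v; rewrite /dsum_cut !linearP. Qed.

End DirectSumRestriction.

Section ChainRestriction.
Variables (A : pzRingType) (X : choiceType) (lt : X -> X -> Prop).
Variables (N : X -> lmodType A) (M M' : lmodType A).
Variables (T : X -> set M) (g : forall x, M -> N x).
Hypothesis ch : filter_chain lt T g.
Variables (Z : set X) (f : {linear M' -> M}).
Hypothesis Zdown : forall x y, Z y -> lt x y -> Z x.
Hypothesis fI : injective f.
Hypothesis fim : forall m, below T Z m <-> exists m', f m' = m.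

(** The map [f] identifies [M'] with the union of the part of the chain indexed by [Z]. Thus a stage
    of a chain is itself filtered by the same factors, and categoricity applies to it. *)
Lemma chain_restrict :
  filter_chain (fun x y : down_type Z => lt (val x) (val y)) (N := fun x => N (val x))
    (fun x m' => T (val x) (f m')) (fun x m' => g (val x) (f m')).
Proof.
have ltO := chain_order ch.
have lift_elt x m : Z x -> T x m -> exists m', f m' = m.
  by move=> Zx xm; apply/fim; right; exists x.
split.
- exact: wto_sub.
- move=> x; have [h0 h] := chain_sub ch (val x).
  by split=> [|a u v xu xv]; rewrite ?linear0// linearP; apply: h.
- by move=> x y xy m; exact: (chain_mono ch xy).
- move=> m'; have /fim : exists m'', f m'' = f m' by exists m'.
  case=> [|[x Zx xm]]; first by rewrite -(linear0 f) => /fI; left.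
  by right; exists (down_elt Zx).
- by move=> x a u v xu xv; rewrite linearP (chain_linear ch).
- move=> x c; have [m xm mc] := chain_surj ch c.
  have [m' e] := lift_elt _ _ (down_typeP x) xm.
  by exists m'; rewrite e.
- move=> x m' xm'; rewrite (chain_ker ch xm'); split.
    case=> [|[y yx ym]]; first by rewrite -(linear0 f) => /fI; left.
    by right; exists (down_elt (Zdown (down_typeP x) yx)).
  case=> [->|[y yx ym]]; first by left; rewrite linear0.
  by right; exists (val y).
Qed.

End ChainRestriction.

Section DirectSumChain.
Variables (A : pzRingType) (X : choiceType) (lt : X -> X -> Prop).
Variable N : X -> lmodType A.
Hypothesis ltO : wf_total_order lt.

Definition dsum_upto (x : X) : set (dsum N) := [set u | forall k, lt x k -> u k = 0].

Lemma dsum_upto_submodule x : is_submodule (dsum_upto x).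
Proof.
by split=> [//|a u v xu xv k xk]; rewrite !coordE xu// xv// scaler0 addr0.
Qed.

Lemma dsum_upto_mono x y : lt x y -> dsum_upto x `<=` dsum_upto y.
Proof. by move=> xy u xu k yk; apply: xu; apply: wto_trans ltO _ _ _ xy yk. Qed.

(** A nonzero element supported in [Z] lies in the term of its leading index, so unions of terms are
    given by a condition on supports. *)
Lemma below_dsum_upto (Z : set X) u : (forall x y, Z y -> lt x y -> Z x) ->
  below dsum_upto Z u <-> forall k, ~ Z k -> u k = 0.
Proof.
move=> Zd; split=> [[->//|[y Zy yu] k Zk]|Zu].
  apply: yu; have [e|//|ky] := wto_total ltO y k; first by rewrite -e in Zk.
  by case: Zk; apply: Zd ky.
have [->|/eqP u0] := eqVneq u 0; first by left.
have [m um mM] := wto_dsum_max ltO u0; right; exists m => //.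
by apply: contrapT => /Zu.
Qed.

Lemma segment_down x y z : init_segment lt z y -> lt x y -> init_segment lt z x.
Proof. by move=> yz xy; apply: wto_trans ltO _ _ _ xy yz. Qed.

Lemma below_segmentP x u :
  below dsum_upto (init_segment lt x) u <-> (dsum_upto x u /\ u x = 0).
Proof.
rewrite below_dsum_upto; last by move=> y z; apply: segment_down.
split=> [h|[xu ux] k xk].
  split=> [k xk|]; last exact: (h x (@wto_irr _ _ ltO x)).
  by apply: (h k) => kx; apply: (wto_irr ltO (wto_trans ltO kx xk)).
have [e|/xu//|//] := wto_total ltO x k; by rewrite -e.
Qed.

Lemma dsum_chain : filter_chain lt dsum_upto (fun x u => u x).
Proof.
split=> //.
- exact: dsum_upto_submodule.
- exact: dsum_upto_mono.
- by move=> u; apply/below_dsum_upto => // k [].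
- move=> x c; exists (dsum_single N x c); last exact: singleE.
  by move=> k xk; apply: single0 => e; rewrite e in xk; apply: (wto_irr ltO xk).
- by move=> x m xm; rewrite below_segmentP; split=> [|[]].
Qed.

End DirectSumChain.

(** * Subquotients presented by maps on the ambient module *)

Section SubQuotient.
Variables (A : pzRingType) (M N : lmodType A) (T S : submodClosed M).

(** An epimorphism from [T] whose kernel is the trace of [S]; it is a function on all of [M], of
    which only the values on [T] count, so that no subtype or quotient is involved. *)
Definition presents_subquotient (g : M -> N) : Prop :=
  [/\ forall a u v, u \in T -> v \in T -> g (a *: u + v) = a *: g u + g v,
      forall c, exists2 m, m \in T & g m = c &
      forall m, m \in T -> (g m = 0 <-> m \in S)].

Lemma quotient_proj_linear (L : lmodType A) (U : submodClosed L) :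
  linear (@quotient_proj A L U).
Proof. by move=> a u v; rewrite quotient_projD quotient_projZ. Qed.

Lemma quotient_proj_eq0 (L : lmodType A) (U : submodClosed L) (x : L) :
  (quotient_proj U x = 0) <-> x \in U.
Proof.
have e0 : quotient_proj U 0 = 0 := linear0 (linear_of (@quotient_proj_linear _ U)).
rewrite -{1}e0 -[x in X in _ <-> X]subr0 -quotient_proj_eq.
by split=> [->|/eqP].
Qed.

Lemma subquotient_presentation :
  isomorphic (subquotient T S) N -> exists g, presents_subquotient g.
Proof.
move=> [f fb]; pose q := linear_of (@quotient_proj_linear _ (trace T S)).
pose sub (x : M) (Tx : x \in T) : submodule T := Submodule Tx.
exists (fun x => if pselect (x \in T) is left Tx then f (q (sub x Tx)) else 0).
have gE x (Tx : x \in T) : (if pselect (x \in T) is left Tx then f (q (sub x Tx)) else 0)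
    = f (q (sub x Tx)).
  by case: pselect => // Tx'; congr (f (q _)); apply: val_inj.
split=> [a u v Tu Tv|c|m Tm].
- have Tuv : a *: u + v \in T by rewrite rpredD// rpredZ.
  rewrite !gE -!linearP; congr (f (q _)).
  by apply: val_inj; rewrite linearP.
- have [f' fK f'K] := fb; pose t := quotient_repr (f' c).
  exists (val t); first exact: valP.
  have Tt := valP t; rewrite (gE _ Tt) -[RHS]f'K -[f' c]quotient_reprK; congr (f _).
  by congr (quotient_proj _ _); apply: val_inj.
- rewrite gE; split=> [e|Sm].
    have /quotient_proj_eq0 : q (sub m Tm) = 0.
      by apply: (bij_inj fb); rewrite linear0.
    by [].
  have -> : q (sub m Tm) = 0 by apply/quotient_proj_eq0.
  exact: linear0.
Qed.

Lemma rpred_sub (U : submodClosed M) (u v : M) : u \in U -> v \in U -> u - v \in U.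
Proof. by move=> Uu Uv; rewrite -scaleN1r rpredD ?rpredZ. Qed.

Lemma trace_sub (u v : submodule T) : (u - v \in trace T S) = (val u - val v \in S).
Proof. by rewrite -linearB. Qed.

Lemma presented_subquotient g :
  presents_subquotient g -> isomorphic (subquotient T S) N.
Proof.
move=> [gL gS gK]; pose h (x : subquotient T S) : N := g (val (quotient_repr x)).
have gB u v : u \in T -> v \in T -> g (u - v) = g u - g v.
  by move=> Tu Tv; rewrite addrC -scaleN1r gL// scaleN1r addrC.
have hE (t : submodule T) : h (quotient_proj _ t) = g (val t).
  apply/eqP; rewrite -subr_eq0 -gB; try exact: valP.
  apply/eqP; rewrite gK; last by apply: rpred_sub; apply: valP.
  have : quotient_repr (quotient_proj (trace T S) t) - t \in trace T S.
    by rewrite -quotient_proj_eq quotient_reprK.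
  by rewrite trace_sub.
have hL : linear h.
  move=> a x y; rewrite -[x]quotient_reprK -[y]quotient_reprK.
  by rewrite -(@quotient_proj_linear _ (trace T S)) !hE linearP gL//; apply: valP.
apply: (@inj_surj_isomorphic _ _ _ (linear_of hL)) => [x y|c].
  rewrite !linear_ofE -[x]quotient_reprK -[y]quotient_reprK !hE => e.
  apply/eqP; rewrite quotient_proj_eq.
  have : val (quotient_repr x) - val (quotient_repr y) \in S.
    rewrite -gK; last by apply: rpred_sub; apply: valP.
    by rewrite gB ?e ?subrr//; apply: valP.
  by rewrite trace_sub.
have [m Tm <-] := gS c; exists (quotient_proj _ (Submodule Tm)).
by rewrite linear_ofE hE.
Qed.

End SubQuotient.

(** * Passing between filtrations and chains *)

Section FiltrationChain.
Variables (A : pzRingType) (J : choiceType) (C : J -> lmodType A).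

Definition from_family (N : lmodType A) : Prop := exists j, N = C j.

(** Only the indices at which the filtration strictly grows are kept. All factors are then nonzero,
    which later bounds the number of summands by the size of the module. *)
Lemma Filt_chain (M : lmodType A) : Filt from_family M ->
  exists (X : choiceType) (lt : X -> X -> Prop) (j : X -> J) (T : X -> set M)
    (g : forall x, M -> C (j x)),
    (forall x, exists c : C (j x), c <> 0) /\ filter_chain lt T g.
Proof.
move=> [sigma [le [F [wo [Fmono F0 Fcov Flim Fsucc]]]]].
pose P i := exists j, is_succ le i j /\ exists2 m, m \in F j & m \notin F i.
pose X : choiceType := {i : sigma | `[<P i>]}.
have /choice[s sP] : forall x : X, exists j, is_succ le (val x) j /\
    exists2 m, m \in F j & m \notin F (val x).
  by case=> x /= /asboolP.
have /choice[j /dependent_choice[g gP]] : forall x : X, exists (j : J), exists g : M -> C j,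
    presents_subquotient (F (s x)) (F (val x)) g.
  move=> x; have [N [j ->] iso] := Fsucc _ _ (sP x).1.
  by exists j; apply: subquotient_presentation.
pose T (x : X) : set M := [set m | m \in F (s x)].
pose lt (x y : X) := strictly le (val x) (val y).
have succ_le (x : X) i : strictly le (val x) i -> le (s x) i.
  by move=> [xi nxi]; have [[_ _ h] _] := sP x; apply: h.
have le_succ (x : X) : strictly le (val x) (s x) by have [[]] := sP x.
(* By induction on [i]: every nonzero element of [F i] has entered at a strict step before [i].
   Continuity handles the limits. *)
have FE i m : m \in F i -> m = 0 \/ exists2 y : X, strictly le (val y) i & T y m.
  elim/(well_founded_ind (strict_wf wo)): i m => i IH m mi.
  have [li|nli] := pselect (is_least le i).
    by left; move: mi; rewrite (F0 _ li) inE => /eqP.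
  have [[k ki]|nsi] := pselect (exists k, is_succ le k i); last first.
    have /Flim/(_ m)[+ _] : is_limit le i by [].
    move=> /(_ mi)[k [ki nki mk]].
    have [->|[y yk ym]] := IH _ (conj ki nki) _ mk; first by left.
    by right; exists y => //; apply: (strict_trans wo) yk _.
  have ski : strictly le k i by case: ki.
  have [mk|mk] := boolP (m \in F k).
    have [->|[y yk ym]] := IH _ ski _ mk; first by left.
    by right; exists y => //; apply: (strict_trans wo) yk _.
  have Pk : P k by exists i; split=> //; exists m.
  pose y : X := exist _ k (asboolT Pk).
  right; exists y => //; rewrite /T/=.
  apply: (Fmono i) mi; have [_ _ h] := ki.
  by have [? ?] := le_succ y; apply: h.
have EF (i : sigma) (y : X) m : strictly le (val y) i -> T y m -> m \in F i.
  by move=> /succ_le yi ym; apply: Fmono yi _ ym.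
exists X, lt, j, T, g; split.
  move=> x; have [_ [m ms mx]] := sP x; have [_ _ gK] := gP x.
  by exists (g x m) => /gK => /(_ ms); apply/negP.
split.
- split.
  + move=> x; have [i e] : exists i, val x = i by exists (val x).
    elim/(well_founded_ind (strict_wf wo)): i x e => i IH x e.
    by split=> y yx; apply: IH (erefl _); rewrite -e.
  + by move=> x y z; apply: (strict_trans wo).
  + by move=> x y; have [/val_inj->|xy|yx] := strict_total wo (val x) (val y);
      [constructor|constructor 2|constructor 3].
- move=> x; split=> [|a u v xu xv]; first exact: rpred0.
  by rewrite /T/= rpredD ?rpredZ.
- move=> x y xy m; apply: Fmono; have [xy' nxy] := xy.
  by have := succ_le _ _ xy; have [yy _] := le_succ y; move=> h; apply: (wo_trans wo) h yy.
- move=> m; have [i /FE[->|[y _ ym]]] := Fcov m; first by left.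
  by right; exists y.
- by move=> x a u v xu xv; have [h _ _] := gP x; apply: h.
- by move=> x c; have [_ h _] := gP x; have [m] := h c; exists m.
- move=> x m xm; have [_ _ h] := gP x; rewrite (h _ xm); split.
    by move=> /FE[->|[y yx ym]]; [left|right; exists y].
  by move=> [->|[y yx ym]]; [exact: rpred0|exact: EF ym].
Qed.

(** The term of index [Some x] is what precedes step [x]. The top index [None] carries the whole of
    [M], so that a last step, if there is one, also has a successor. *)
Lemma chain_Filt (M : lmodType A) (X : choiceType) (lt : X -> X -> Prop)
    (j : X -> J) (T : X -> set M) (g : forall x, M -> C (j x)) :
  filter_chain lt T g -> Filt from_family M.
Proof.
move=> ch; have ltO := chain_order ch.
pose le (o p : option X) : bool :=
  match o, p with
  | _, None => true
  | None, Some _ => false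
  | Some x, Some y => `[<x = y \/ lt x y>]
  end.
pose seg (o : option X) : set X := if o is Some x then init_segment lt x else setT.
pose F o : submodClosed M := set_pred (below_submodule ch (seg o)).
have FP o m : m \in F o <-> below T (seg o) m by rewrite in_set_pred; split=> /asboolP.
have seg_le o p : le o p -> seg o `<=` seg p.
  case: o p => [x|] [y|]//= /asboolP[->//|xy] z zx.
  exact: (wto_trans ltO zx xy).
have le_nlt x y : ~~ le (Some x) (Some y) -> lt y x.
  move=> /asboolPn nxy; have [e|xy|//] := wto_total ltO x y; case: nxy; auto.
have le_tot o p : le o p || le p o.
  case: o p => [x|] [y|]//=; have [->|xy|yx] := wto_total ltO x y.
  - by rewrite asboolT//; left.
  - by rewrite asboolT//; right.
  - by rewrite [X in _ || X]asboolT ?orbT//; right.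
have le_anti o p : le o p -> le p o -> o = p.
  case: o p => [x|] [y|]//= /asboolP[->//|xy] /asboolP[->//|yx].
  by case: (wto_irr ltO (wto_trans ltO xy yx)).
have wo : well_order le.
  move=> B [o Bo].
  suff [m Bm mB] : exists2 m, m \in B & forall p, p \in B -> le m p.
    exists m; split=> [|p [Bp pB]]; first by split.
    by apply: le_anti; [apply: mB|apply: pB].
  have [ex|N] := pselect ([set x | Some x \in B] !=set0).
    have [x Bx xm] := wto_least ltO ex; exists (Some x) => // -[y By|//].
    by have /orP[//|] := le_tot (Some x) (Some y); move=> /asboolP[->|yx];
      [apply/asboolP; left|case: (xm y)].
  exists None; first by case: o Bo => // x Bx; case: N; exists x.
  by move=> [x Bx|//]; case: N; exists x.
exists (option X), le, F; split=> //; split.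
- move=> o p op m /FP[->|[y yo ym]]; apply/FP; [by left|right].
  by exists y => //; apply: seg_le op _ yo.
- move=> o oleast m; rewrite [RHS]inE; apply/idP/eqP => [/FP[//|[y yo ym]]|->].
    have := oleast (Some y); case: o yo {oleast} => [x|]//= yx /asboolP[e|xy].
      by move: yx; rewrite /init_segment/= e => /(wto_irr ltO).
    by case: (wto_irr ltO (wto_trans ltO xy yx)).
  exact: rpred0.
- by move=> m; exists None; apply/FP; exact: (chain_cover ch m).
- move=> p [nleast nsucc] m; split=> [/FP[->|[y yp ym]]|].
  + have [k /negP npk] : exists k, ~ le p k by apply/existsNP.
    exists k; split; [|by move=> e; rewrite e in npk; have := le_tot p p; rewrite orbb (negbTE npk)|exact: rpred0].
    by have := le_tot p k; rewrite (negbTE npk).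
  + have yp' : le (Some y) p /\ Some y <> p.
      split; first by case: (p) yp => //= x yx; apply/asboolP; right.
      by move=> e; move: yp; rewrite -e => /(wto_irr ltO).
    (* As [p] is not the successor of [y], some [k] lies strictly between them, and its term
       contains [T y]. *)
    have [k [yk nyk /negP npk]] : exists k, [/\ le (Some y) k, Some y <> k & ~ le p k].
      apply: contrapT => N; apply: nsucc; exists (Some y).
      split; [by case: yp'|by case: yp'|move=> k yk nyk].
      by apply: contrapT => npk; apply: N; exists k.
    exists k; split.
    * by have := le_tot p k; rewrite (negbTE npk).
    * by move=> e; rewrite e in npk; have := le_tot p p; rewrite orbb (negbTE npk).
    * apply/FP; right; exists y => //; case: k yk nyk {npk} => //= z /asboolP[->//|//].
  + move=> [o [op _ /FP[->|[y yo ym]]]]; first exact: rpred0.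
    by apply/FP; right; exists y => //; apply: seg_le op _ yo.
- move=> [x|] p [xp nxp px]; last by case: p xp nxp px.
  exists (C (j x)); first by exists (j x).
  have Fp m : m \in F p <-> T x m.
    split=> [/FP[->|[y yp ym]]|xm]; [by have [] := chain_sub ch x| |].
      have [e|xy|yx] := wto_total ltO x y; [by rewrite e| |exact: (chain_mono ch yx ym)].
      have : le p (Some y) by apply: px => [|[e]]; [apply/asboolP; right|rewrite e in xy; case: (wto_irr ltO xy)].
      case: p yp {xp nxp px} => //= z yz /asboolP[e|zy].
        by move: yz; rewrite e => /(wto_irr ltO).
      by case: (wto_irr ltO (wto_trans ltO zy yz)).
    apply/FP; right; exists x => //; case: p xp nxp {px} => //= y /asboolP[->//|//].
  apply: (@presented_subquotient _ _ _ _ _ (g x)); split.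
  + by move=> a u v /Fp xu /Fp xv; apply: chain_linear ch _ _ _ _ xu xv.
  + by move=> c; have [m xm mc] := chain_surj ch c; exists m => //; apply/Fp.
  + by move=> m /Fp xm; rewrite (chain_ker ch xm) FP.
Qed.

End FiltrationChain.

(** * Splitting of extensions *)

Section Sections.
Variables (A : pzRingType) (X : choiceType) (lt : X -> X -> Prop).
Variables (N : X -> lmodType A) (M : lmodType A).
Variables (T : X -> set M) (g : forall x, M -> N x).
Hypothesis ch : filter_chain lt T g.
Variable Z : set X.
Hypothesis Zdown : forall x y, Z y -> lt x y -> Z x.
Variable h : forall z : down_type Z, {linear N (val z) -> M}.
Hypothesis hT : forall (z : down_type Z) c, T (val z) (h z c).
Hypothesis hg : forall (z : down_type Z) c, g (val z) (h z c) = c.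

Let ltO := chain_order ch.
Let ltZ (x y : down_type Z) := lt (val x) (val y).

(** If [u] is sent to 0, its leading term is sent to minus the image of the lower ones, hence into
    the earlier stage, where [g] vanishes; but [g] recovers the leading coordinate. *)
Lemma lift_sections_inj : injective (dsum_lift h).
Proof.
have ltZO : wf_total_order ltZ by apply: wto_sub.
suff ker u : dsum_lift h u = 0 -> u = 0.
  by move=> u v e; apply/eqP; rewrite -subr_eq0; apply/eqP/ker; rewrite linearB e subrr.
move=> lu0; apply: contrapT => /(wto_dsum_max ltZO)[m um mM]; apply: um.
rewrite -(hg (u m)); apply/(chain_ker ch) => //.
have -> : h m (u m) = - dsum_lift h (u - dsum_single _ m (u m)).
  by rewrite linearB lu0 sub0r opprK dsum_lift_single.
have sub := below_submodule ch (init_segment lt (val m)).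
apply: is_submoduleN => //; apply: dsum_lift_in => // i ui.
right; exists (val i); last exact: hT.
have [e|//|mi] := wto_total ltZO i m; case: ui.
  by subst i; rewrite !coordE singleE subrr.
rewrite !coordE mM// single0 ?subrr// => e.
by rewrite e in mi; case: (wto_irr ltZO mi).
Qed.

(** Subtracting from [m] the section applied to its class in the factor leaves an element of an
    earlier stage, to which induction applies. *)
Lemma lift_sections_im m : below T Z m <-> exists u, dsum_lift h u = m.
Proof.
split=> [[->|[y Zy ym]]|[u <-]]; first by exists 0; rewrite linear0.
  elim/(wto_ind ltO): y m Zy ym => y IH m Zy ym.
  pose z : down_type Z := down_elt Zy.
  have yr : T y (m - h z (g y m)).
    by apply: is_submoduleB => //; [exact: chain_sub ch y|exact: (@hT z _)].
  have : below T (init_segment lt y) (m - h z (g y m)).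
    apply/(chain_ker ch) => //; rewrite (chainB ch)//; last exact: (@hT z _).
    by apply/eqP; rewrite subr_eq0 eq_sym; apply/eqP; apply: (@hg z _).
  case=> [/eqP|[y' y'y y'm]].
    by rewrite subr_eq0 => /eqP e; exists (dsum_single _ z (g y m)); rewrite dsum_lift_single.
  have [u uE] := IH _ y'y _ (Zdown Zy y'y) y'm.
  exists (u + dsum_single _ z (g y m)); rewrite linearD uE dsum_lift_single subrK//.
apply: dsum_lift_in => [|i _]; first exact: below_submodule ch Z.
by right; exists (val i); [exact: down_typeP|exact: hT].
Qed.

End Sections.

(** * Vanishing of Ext through the canonical free presentation *)

Section Extensions.
Variables (A : pzRingType) (C : lmodType A).

(** Free on the underlying set of [C]: the presentation is canonical and its size is controlled by
    those of [A] and [C]. *)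
Definition free_module : lmodType A := dsum (fun _ : C => A^o : lmodType A).

Fact scale_linear (M : lmodType A) (m : M) : linear (fun a : A^o => (a : A) *: m).
Proof. by move=> a x y; rewrite scalerDl scalerA. Qed.

Definition free_lift (M : lmodType A) (s : C -> M) : {linear free_module -> M} :=
  dsum_lift (fun c => linear_of (scale_linear (s c))).

Definition free_basis (c : C) : free_module := dsum_single (fun _ : C => A^o : lmodType A) c (1 : A).

Lemma free_lift_basis (M : lmodType A) (s : C -> M) c : free_lift s (free_basis c) = s c.
Proof. by rewrite dsum_lift_single linear_ofE scale1r. Qed.

Definition free_relations : set free_module := [set u | free_lift id u = 0].

Lemma relations_submodule : is_submodule free_relations.
Proof.
split=> [|a u v]; first exact: linear0.
move=> u0 v0; suff : free_lift id (a *: u + v) = 0 by [].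
by rewrite linearP [X in a *: X]u0 [X in _ + X]v0 scaler0 addr0.
Qed.

(** A homomorphism defined on the relations, encoded as a function on the whole free module that is
    constrained only there. *)
Definition relation_map (P : lmodType A) (f : free_module -> P) : Prop :=
  forall a u v, free_relations u -> free_relations v -> f (a *: u + v) = a *: f u + f v.

(* Ext^1(C, P) = 0, computed from the free presentation of C. *)
Definition ext_vanish (P : lmodType A) : Prop :=
  forall f : free_module -> P, relation_map f ->
  exists e : {linear free_module -> P}, forall k, free_relations k -> e k = f k.

Lemma ext_vanish_retract (P Q : lmodType A) (i : {linear P -> Q}) (p : {linear Q -> P}) :
  cancel i p -> ext_vanish Q -> ext_vanish P.
Proof.
move=> ip extQ f fr.
have [e eE] : exists e : {linear free_module -> Q}, forall k, free_relations k -> e k = i (f k).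
  by apply: extQ => a u v ur vr; rewrite fr// linearP.
have pL : linear (p \o e) by move=> a u v /=; rewrite !linearP.
by exists (linear_of pL) => k /eE e'; rewrite linear_ofE /= e' ip.
Qed.

(** A set-theoretic section [s] extends to [S] on the free module and sends relations into the image
    of [P]. Extending this map on relations to [e] on the free module, the difference of [S] and
    [f \o e] kills the relations and induces the section. *)
Lemma ext_vanish_section (M P : lmodType A) (T : set M) (g : M -> C) (f : {linear P -> M}) :
  is_submodule T -> (forall a u v, T u -> T v -> g (a *: u + v) = a *: g u + g v) ->
  (forall c, exists2 m, T m & g m = c) ->
  (forall m, T m -> (g m = 0 <-> exists p, f p = m)) ->
  (forall p, T (f p)) -> injective f -> ext_vanish P ->
  exists h : {linear C -> M}, (forall c, T (h c)) /\ (forall c, g (h c) = c).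
Proof.
move=> Tsub gL gS gK fT fI ext.
have /choice[s sP] : forall c, exists m, T m /\ g m = c.
  by move=> c; have [m Tm mc] := gS c; exists m.
pose S := free_lift s.
have ST u : T (S u).
  apply: dsum_lift_in => // c _; rewrite linear_ofE; apply: is_submoduleZ => //.
  by case: (sP c).
have g0 : g 0 = 0 by apply/gK; [case: Tsub|exists 0; apply: linear0].
have gZ a u : T u -> g (a *: u) = a *: g u.
  by move=> Tu; rewrite -[a *: u]addr0 gL ?g0 ?addr0//; case: Tsub.
have gD u v : T u -> T v -> g (u + v) = g u + g v.
  by move=> Tu Tv; rewrite -{1}[u]scale1r gL// scale1r.
have gB u v : T u -> T v -> g (u - v) = g u - g v.
  by move=> Tu Tv; rewrite gD -?scaleN1r ?gZ//; apply: is_submoduleZ.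
have gSe u : g (S u) = free_lift id u.
  rewrite [S u]dsum_liftE [RHS]dsum_liftE; elim: (supp_seq u) => [|c t IH].
    by rewrite !big_nil.
  have [sT sc] := sP c.
  rewrite !big_cons gD; first by rewrite IH; congr (_ + _); rewrite !linear_ofE gZ// sc.
    exact: is_submoduleZ.
  apply: is_submodule_sum => // i; apply: is_submoduleZ => //.
  by case: (sP i).
have /choice[r rP] : forall k, exists p, free_relations k -> f p = S k.
  move=> k; have [kr|N] := pselect (free_relations k); last by exists 0 => /N.
  have [h _] := gK _ (ST k); have [|p e] := h; first by rewrite gSe.
  by exists p.
have rr : relation_map r.
  move=> a u v ur vr; apply: fI; rewrite linearP !rP// ?linearP//.
  by have [_] := relations_submodule; apply.
have [e eE] := ext _ rr.
have SeT u : T (S u - f (e u)) by apply: is_submoduleB.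
have Se0 k : free_relations k -> S k - f (e k) = 0.
  by move=> kr; rewrite eE// rP// subrr.
have gf p : g (f p) = 0 by apply/gK => //; exists p.
have WL : linear (fun u => S u - f (e u)).
  by move=> a u v; rewrite !linearP /= addrACA -scalerDr.
pose W := linear_of WL.
(* The failure of [free_basis] to be linear is a relation, which [W] kills. *)
have hL : linear (fun c => W (free_basis c)).
  move=> a c c'; apply/eqP; rewrite -subr_eq0 -linearP -linearB; apply/eqP.
  apply: Se0; red; rewrite /mkset linearB linearP !free_lift_basis.
  by rewrite subrr.
exists (linear_of hL); split=> c; first exact: SeT.
rewrite -[linear_of _ _]/(S (free_basis c) - f (e (free_basis c))).
by rewrite gB// gf subr0 gSe free_lift_basis.
Qed.

Lemma card_le_free (L : Type) : infinite_set [set: L] ->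
  [set: A] #<= [set: L] -> [set: C] #<= [set: L] -> [set: free_module] #<= [set: L].
Proof. by move=> Linf AL CL; apply: card_le_dsum. Qed.

(* A homomorphism from the relations of C meets at most as many summands as the
   free module on C has elements. *)
Lemma ext_vanish_dsum (L : choiceType) (J : Type) (D : J -> lmodType A) :
  infinite_set [set: L] -> [set: A] #<= [set: L] -> [set: C] #<= [set: L] ->
  (forall (I : choiceType) (j : I -> J), [set: I] #<= [set: L] ->
     ext_vanish (dsum (fun i => D (j i)))) ->
  forall (I : choiceType) (j : I -> J), ext_vanish (dsum (fun i => D (j i))).
Proof.
move=> Linf AL CL small I j f fr.
pose B : set I := [set i | exists k, f k i <> 0].
have BL : B #<= [set: L].
  apply: card_le_trans (card_le_bigcup Linf (P := [set: free_module])
    (D := fun k => [set i | i \in supp_seq (f k)]) (card_le_free Linf AL CL) _).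
    apply: subset_card_le => i [k ki]; exists k => //=.
    by apply: contrapT => /negP/supp_seqP.
  move=> k _; apply: card_le_trans (card_nat_le Linf).
  by apply: finite_set_countable; apply: finite_seq.
pose I' := down_type B.
have I'L : [set: I'] #<= [set: L] := card_le_trans (card_down_type B) BL.
pose D' (x : I') := D (j (val x)).
pose res := dsum_restrict (fun i => D (j i)) B; pose inc := dsum_extend (fun i => D (j i)) B.
have incK k : inc (res (f k)) = f k.
  apply: cut_id => i nBi; apply: contrapT => ki; apply: nBi; exists k.
  exact: ki.
have [e eE] : exists e : {linear free_module -> dsum D'}, forall k, free_relations k -> e k = res (f k).
  by apply: small => // a u v ur vr; rewrite fr// linearP.
have iL : linear (fun u => inc (e u)).
  by move=> a u v; rewrite (linearP e) (linearP inc).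
exists (linear_of iL) => k /eE e'.
by rewrite -[LHS]/(inc (e k)) e' incK.
Qed.

End Extensions.

Section Splitting.
Variables (A : pzRingType) (J : choiceType) (C : J -> lmodType A).
Hypothesis ext : forall j (I : choiceType) (i : I -> J),
  ext_vanish (C j) (dsum (fun x => C (i x))).

(** By induction on [x]: sections of the earlier steps turn the stage before [x] into a direct sum
    of members of the family, so [ext] provides a section at [x]. *)
Lemma chain_split (M : lmodType A) (X : choiceType) (lt : X -> X -> Prop)
    (j : X -> J) (T : X -> set M) (g : forall x, M -> C (j x)) :
  filter_chain lt T g ->
  isomorphic (dsum (fun x : down_type [set: X] => C (j (val x)))) M.
Proof.
move=> ch; have ltO := chain_order ch.
have sections (Z : set X) : (forall z : down_type Z, exists h : {linear C (j (val z)) -> M},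
      (forall c, T (val z) (h c)) /\ (forall c, g (val z) (h c) = c)) ->
    (forall x y, Z y -> lt x y -> Z x) ->
    exists f : {linear dsum (fun z : down_type Z => C (j (val z))) -> M},
      injective f /\ forall m, below T Z m <-> exists u, f u = m.
  move=> /dependent_choice[h hP] Zdown; exists (dsum_lift h); split.
    by apply: (lift_sections_inj ch) => z c; case: (hP z).
  by apply: (lift_sections_im ch) => // z c; case: (hP z).
have ex x : exists h : {linear C (j x) -> M},
    (forall c, T x (h c)) /\ (forall c, g x (h c) = c).
  elim/(wto_ind ltO): x => x IH.
  have [|y z|f [fI fim]] := sections (init_segment lt x).
  - by move=> z; apply: IH; apply: down_typeP z.
  - exact: segment_down.
  have gK m : T x m -> (g x m = 0 <-> exists p, f p = m).
    by move=> xm; rewrite (chain_ker ch xm) fim.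
  have fT p : T x (f p) by apply: (below_segment ch); apply/fim; exists p.
  exact: (ext_vanish_section (chain_sub ch x) (@chain_linear _ _ _ _ _ _ _ ch x)
    (@chain_surj _ _ _ _ _ _ _ ch x) gK fT fI (@ext _ _ _)).
have [//|//|f [fI fim]] := sections [set: X].
by apply: (inj_surj_isomorphic fI) => m; apply/fim; apply: chain_cover ch m.
Qed.

End Splitting.

(** * Amalgamation of extensions along a well-order *)

(** Two relations with their witnesses add up, apart from the last term, which is the defect of
    linearity of the attaching map. *)
Lemma zmod_cocycle (V : zmodType) (p q i i' s s' t : V) :
  p + q - (i + i' - t) = (p - (i - s)) + (q - (i' - s')) + (t - (s + s')).
Proof.
have -> : (p - (i - s)) + (q - (i' - s')) = p + q - (i + i' - (s + s')).
  by rewrite addrACA -opprD addrACA -opprD.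
rewrite -[RHS]addrA; congr (_ + _).
by rewrite !opprB [RHS]addrC subrKA.
Qed.

(** Recursion along [lt] for sets inside a fixed module; it produces the relations of the
    amalgam. *)
Lemma wf_family (X : Type) (lt : X -> X -> Prop) (V : nmodType)
    (F : X -> set V -> set V) : well_founded lt ->
  exists T : X -> set V, forall x, T x = F x (below T (init_segment lt x)).
Proof.
move=> wf; pose G x (rec : forall y, lt y x -> set V) : set V :=
  F x [set m | m = 0 \/ exists y (yx : lt y x), rec y yx m].
exists (Fix wf (fun=> set V) G) => x; rewrite Fix_eq.
  congr F; apply/seteqP; split=> m [->|]; [by left| |by left|].
    by move=> [y [yx ym]]; right; exists y.
  by move=> [y yx ym]; right; exists y, yx.
move=> {}x f g fg; congr F; apply/seteqP; split=> m [->|[y [yx]]]; try by left.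
  by rewrite fg => ym; right; exists y, yx.
by rewrite -fg => ym; right; exists y, yx.
Qed.

Section Amalgam.
Variables (A : pzRingType) (X : choiceType) (lt : X -> X -> Prop).
Variables (C : lmodType A).
Hypothesis ltO : wf_total_order lt.

Notation F := (free_module C).
Let Phi : lmodType A := dsum (fun _ : X => F).
Let at_ (x : X) : {linear F -> Phi} := dsum_single (fun _ : X => F) x.
Let upto (x : X) : set Phi := dsum_upto lt (N := fun _ : X => F) x.
Let before (x : X) : set Phi := [set u | forall k, ~ lt k x -> u k = 0].

(* The union of the chain is the quotient of [Phi], one copy of [free_module C] per
   step, by relations [Rel] added one step at a time: at step [x] they identify,
   for every relation [k] of [C], the copy of [k] at [x] with an element [g k]
   of the earlier copies. This is the pushout of [free_module C] along [g], which need
   only be linear modulo the earlier relations [S]. *)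
Definition attaching x (S : set (dsum (fun _ : X => free_module C)))
    (g : F -> dsum (fun _ : X => free_module C)) : Prop :=
  (forall k, free_relations k -> before x (g k)) /\
  (forall a u v, free_relations u -> free_relations v ->
     S (g (a *: u + v) - (a *: g u + g v))).

Variable G : X -> set Phi -> F -> Phi.
Hypothesis Gatt : forall x S, S 0 -> attaching x S (G x S).

Variable Rel : X -> set Phi.
Let S x : set Phi := below Rel (init_segment lt x).
Hypothesis RelE : forall x, Rel x =
  [set w | exists2 k, free_relations k & S x (w - (at_ x k - G x (S x) k))].

Let Satt x : attaching x (S x) (G x (S x)).
Proof. by apply: Gatt; left. Qed.

Let upto_submodule x : is_submodule (upto x).
Proof. exact: dsum_upto_submodule. Qed.

Lemma before_upto x u : before x u <-> (upto x u /\ u x = 0).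
Proof.
rewrite -(below_segmentP ltO) below_dsum_upto//.
by move=> y z; apply: segment_down.
Qed.

Lemma upto_before x y : lt x y -> upto x `<=` before y.
Proof.
move=> xy u xu k ky; apply: xu; have [e|//|kx] := wto_total ltO x k.
  by rewrite e in xy.
by case: ky; apply: (wto_trans ltO kx xy).
Qed.

(** The clauses need each other at smaller indices. The last one is the injectivity of a pushout: a
    relation of step [x] has as coordinate at [x] the [k] it comes from, so if it vanishes there
    then [k = 0] and it was already an earlier relation. *)
Lemma Rel_invariant x :
  [/\ is_submodule (Rel x), forall y, lt y x -> Rel y `<=` Rel x,
      Rel x `<=` upto x, forall w, Rel x w -> free_relations (w x) &
      forall w, Rel x w -> before x w -> S x w].
Proof.
elim/(wto_ind ltO): x => x IH.
have Ssub : is_submodule (S x).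
  apply: (below_is_submodule ltO) => [y yx|y z yx zx yz]; first by case: (IH y yx).
  by case: (IH z zx) => _ + _ _ _; apply.
have Sbefore w : S x w -> before x w.
  move=> [->//|[y yx yw]]; apply: (upto_before yx).
  by case: (IH y yx) => _ _ + _ _; apply.
have [Gb Gl] := Satt x; set g := G x (S x) in Gb Gl.
have r0 : free_relations (0 : F) by case: (relations_submodule C).
(* Linear only modulo [S x], the map [g] sends 0 to an earlier relation rather than to 0. *)
have g0 : S x (g 0).
  have := Gl 1 _ _ r0 r0; rewrite !scale1r !addr0 opprD addrA subrr sub0r.
  by move=> /(is_submoduleN Ssub); rewrite opprK.
have RelP w : Rel x w <-> exists2 k, free_relations k & S x (w - (at_ x k - g k)).
  by rewrite RelE.
have SRel w : S x w -> Rel x w.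
  move=> Sw; apply/RelP; exists 0 => //; rewrite linear0 sub0r opprK.
  exact: is_submoduleD.
(* From [x] on, [w] agrees with the copy of [k] at [x], because [g k] and [S x] live strictly
   before. *)
have wit w k : free_relations k -> S x (w - (at_ x k - g k)) ->
    w x = k /\ forall m, lt x m -> w m = 0.
  move=> kr Sw.
  have key m : ~ lt m x -> w m = at_ x k m.
    move=> mx; have := Sbefore _ Sw m mx; rewrite !coordE (Gb k kr m mx) oppr0 addr0.
    by move/eqP; rewrite subr_eq0 => /eqP.
  split; first by rewrite key; [exact: singleE|exact: wto_irr].
  move=> m xm; rewrite key; last by move=> mx; apply: (wto_irr ltO (wto_trans ltO xm mx)).
  by apply: single0 => e; rewrite e in xm; apply: (wto_irr ltO xm).
split.
- split; first by apply: SRel; left.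
  move=> a u v /RelP[k kr ku] /RelP[l lr lv]; apply/RelP; exists (a *: k + l).
    by have [_] := relations_submodule C; apply.
  rewrite linearP (zmod_cocycle _ _ _ _ (a *: g k) (g l)) -!scalerBr.
  apply: is_submoduleD => //; last exact: Gl.
  by apply: is_submoduleD => //; apply: is_submoduleZ.
- by move=> y yx w yw; apply: SRel; right; exists y.
- by move=> w /RelP[k kr /(wit _ _ kr)[_]].
- by move=> w /RelP[k kr /(wit _ _ kr)[->]].
- move=> w /RelP[k kr Sw] bw; have [wk _] := wit _ _ kr Sw.
  have k0 : k = 0 by rewrite -wk; apply: bw; apply: wto_irr.
  move: Sw; rewrite k0 linear0 sub0r opprK => /(is_submoduleB Ssub)/(_ g0).
  by rewrite addrK.
Qed.

Let Rel_sub x : is_submodule (Rel x). Proof. by case: (Rel_invariant x). Qed.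

Lemma relations_below_submodule Z : is_submodule (below Rel Z).
Proof.
apply: (below_is_submodule ltO) => [x _|x y _ _ xy]; first exact: Rel_sub.
by case: (Rel_invariant y) => _ + _ _ _; apply.
Qed.

Let Tot : set Phi := below Rel setT.

(** Later steps impose nothing new on the copies up to [x]: descending through the last clause of
    [Rel_invariant] brings the relation down to step [x]. Hence earlier stages embed in the
    amalgam. *)
Lemma Tot_upto x w : Tot w -> upto x w -> Rel x w.
Proof.
move=> [-> _|[y _]]; first by case: (Rel_sub x).
elim/(wto_ind ltO): y w => y IH w yw xw.
have [e|yx|xy] := wto_total ltO y x; first by rewrite -e.
  by have [_ h _ _ _] := Rel_invariant x; apply: h yw.
have [_ _ _ _ Sy] := Rel_invariant y.
have [->|[z zy zw]] := Sy _ yw (upto_before xy xw); first by case: (Rel_sub x).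
exact: (IH z).
Qed.

Lemma Tot_before x w : Tot w -> before x w -> S x w.
Proof.
move=> Tw bw; have [_ _ _ _] := Rel_invariant x; apply => //.
by apply: Tot_upto => //; case/before_upto: bw.
Qed.

Lemma attaching_relation x k : free_relations k -> Tot (at_ x k - G x (S x) k).
Proof.
move=> kr; right; exists x => //; rewrite RelE; exists k => //.
by rewrite subrr; left.
Qed.

Definition amalgam : lmodType A := quotient_module (set_pred (relations_below_submodule setT)).
Definition amalgam_proj : {linear Phi -> amalgam} :=
  linear_of (@quotient_proj_linear A _ (set_pred (relations_below_submodule setT))).

Lemma amalgam_proj_eq0 u : amalgam_proj u = 0 <-> Tot u.
Proof.
rewrite linear_ofE quotient_proj_eq0 in_set_pred.
by split=> [/asboolP|?] //; apply/asboolP.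
Qed.

Lemma amalgam_proj_eq u v : amalgam_proj u = amalgam_proj v <-> Tot (u - v).
Proof.
rewrite -amalgam_proj_eq0 linearB; split=> [->|/eqP]; first by rewrite subrr.
by rewrite subr_eq0 => /eqP.
Qed.

Lemma amalgam_projP l : exists u, amalgam_proj u = l.
Proof. by exists (quotient_repr l); apply: quotient_reprK. Qed.

Definition stage (x : X) : set amalgam := [set l | exists2 u, upto x u & amalgam_proj u = l].

Lemma below_stage Z l : (forall x y, Z y -> lt x y -> Z x) ->
  below stage Z l <-> exists2 u : Phi, (forall k, ~ Z k -> u k = 0) & amalgam_proj u = l.
Proof.
move=> Zd; split=> [[->|[y Zy [u yu <-]]]|[u uZ <-]].
- by exists 0 => //; rewrite linear0.
- by exists u => //; apply/(below_dsum_upto ltO u Zd); right; exists y.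
- have [->|[y Zy yu]] := (below_dsum_upto ltO u Zd).2 uZ; first by left; rewrite linear0.
  by right; exists y => //; exists u.
Qed.

(** The factor map takes a representative supported up to [x] and evaluates its coordinate at [x] in
    [C]. Two representatives differ by an element of [Rel x], whose coordinate at [x] is a relation
    of [C]. *)
Lemma amalgam_chain : exists g, filter_chain lt (N := fun _ : X => C) stage g.
Proof.
have /choice[r rP] : forall p : X * amalgam, exists u, stage p.1 p.2 ->
    upto p.1 u /\ amalgam_proj u = p.2.
  move=> [x l]; have [[u xu e]|N] := pselect (stage x l); first by exists u.
  by exists 0 => /N.
pose eps := free_lift (@id C).
pose g (x : X) (l : amalgam) : C := eps (r (x, l) x).
have gE x u : upto x u -> g x (amalgam_proj u) = eps (u x).
  move=> xu; have [|xr] := rP (x, amalgam_proj u); first by exists u.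
  move=> /amalgam_proj_eq/(@Tot_upto x) h.
  have [_ _ _ ru _] := Rel_invariant x.
  have /ru : Rel x (r (x, amalgam_proj u) - u).
    by apply: h; apply: (is_submoduleB (upto_submodule x)).
  rewrite !coordE /free_relations /mkset linearB => /eqP.
  by rewrite subr_eq0 => /eqP.
exists g; split=> //.
- move=> x; have [h0 h] := upto_submodule x.
  split; first by exists 0 => //; rewrite linear0.
  move=> a _ _ [u xu <-] [v xv <-]; exists (a *: u + v); first exact: h.
  by rewrite linearP.
- move=> x y xy _ [u xu <-]; exists u => //.
  exact: (dsum_upto_mono ltO xy).
- by move=> l; apply/below_stage => //; have [u e] := amalgam_projP l; exists u => // k [].
- move=> x a _ _ [u xu <-] [v xv <-]; rewrite -linearP !gE//; last first.
    by have [_ h] := upto_submodule x; apply: h.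
  by rewrite !coordE linearP.
- move=> x c; have xs : upto x (at_ x (free_basis c)).
    by move=> k xk; apply: single0 => e; rewrite e in xk; apply: (wto_irr ltO xk).
  exists (amalgam_proj (at_ x (free_basis c))); first by exists (at_ x (free_basis c)).
  by rewrite gE// singleE free_lift_basis.
- move=> x _ [u xu <-]; rewrite gE//; split=> [u0|].
    (* If the coordinate [k] at [x] is a relation, subtracting the relation attached to it moves [u]
       strictly before [x]. *)
    have [Gb _] := Satt x; set k := u x in u0.
    apply/below_stage; first by move=> y z; apply: segment_down.
    exists (u - (at_ x k - G x (S x) k)).
      move=> m mx; rewrite !coordE (Gb k u0 m mx) oppr0 addr0.
      have [e|xm|//] := wto_total ltO x m; first by rewrite -e singleE subrr.
      rewrite xu// single0 ?subr0// => e; rewrite e in xm.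
      exact: (wto_irr ltO xm).
    by apply/amalgam_proj_eq; rewrite addrC addKr; apply: is_submoduleN;
      [exact: relations_below_submodule|exact: attaching_relation].
  case=> [e|[y yx [v yv e]]].
    have -> : amalgam_proj u = amalgam_proj 0 -> eps (u x) = 0.
      by move=> e0; rewrite -gE// e0 gE ?linear0.
    by [].
    by rewrite e linear0.
  rewrite -gE// -e gE; first by rewrite yv ?linear0.
  exact: (dsum_upto_mono ltO yx).
Qed.

End Amalgam.

(** * Categoricity makes extensions split *)

Section Closing.
Variables (X : Type) (L : Type).
Hypothesis Linf : infinite_set [set: L].

(** Countably many rounds suffice, since the needs of a point are met one round later. *)
Lemma small_closure (D0 : set X) (Y : set X) (next : X -> set X) :
  D0 #<= [set: L] -> D0 `<=` Y ->
  (forall x, Y x -> next x `<=` Y /\ next x #<= [set: L]) ->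
  exists Z : set X, [/\ D0 `<=` Z, Z `<=` Y, Z #<= [set: L] &
    forall x, Z x -> next x `<=` Z].
Proof.
move=> D0L D0Y nextP.
pose step (D : set X) := \bigcup_(x in D) next x.
have itP n : iter n step D0 #<= [set: L] /\ iter n step D0 `<=` Y.
  elim: n => [//|n [nL nY]] /=; split; last by move=> y [x /nY/nextP[+ _]]; apply.
  (* Sizes are known only for points of [Y], hence the truncation outside it. *)
  have -> : step (iter n step D0) = \bigcup_(x in iter n step D0) (if `[<Y x>] then next x else set0).
    by apply/seteqP; split=> y [x nx]; [|case: asboolP => // Yx] => xy;
      exists x => //; rewrite asboolT//; apply: nY.
  apply: card_le_bigcup => // x; case: asboolP => [/nextP[]//|_ _].
  exact: card_ge0.
exists (\bigcup_n iter n step D0); split.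
- by move=> x D0x; exists 0%N.
- by move=> x [n _]; apply: (itP n).2.
- by apply: card_le_bigcup => // [|n _]; [exact: card_nat_le|case: (itP n)].
- by move=> x [n _ nx] y xy; exists n.+1 => //; exists x.
Qed.

End Closing.

(** * Two categoricity cardinals force Ext to vanish *)

Section KeyLemma.
Variables (A : pzRingType) (C P : lmodType A) (L X : choiceType) (le : rel X).
Hypothesis wo : well_order le.
Notation lt := (strictly le).
Hypothesis Linf : infinite_set [set: L].
Hypothesis LX : [set: L] #<= [set: X].
Hypothesis XL : ~ ([set: X] #<= [set: L]).
Hypothesis AL : [set: A] #<= [set: L].
Hypothesis CL : [set: C] #<= [set: L].
Hypothesis Cn0 : exists c : C, c <> 0.
Hypothesis cat_L : forall (M : lmodType A) (Y : choiceType) (ltY : Y -> Y -> Prop)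
  T (g : forall y, M -> C), filter_chain ltY (N := fun=> C) T g ->
  [set: M] #= [set: L] -> isomorphic M P.
Hypothesis cat_X : forall (M M' : lmodType A) (Y Y' : choiceType)
  (ltY : Y -> Y -> Prop) (ltY' : Y' -> Y' -> Prop) T (g : forall y, M -> C)
  T' (g' : forall y, M' -> C),
  filter_chain ltY (N := fun=> C) T g -> filter_chain ltY' (N := fun=> C) T' g' ->
  [set: M] #= [set: X] -> [set: M'] #= [set: X] -> isomorphic M M'.

Notation F := (free_module C).
Notation Phi := (dsum (fun _ : X => F)).
Notation at_ := (dsum_single (fun _ : X => F)).

Let ltO : wf_total_order lt.
Proof.
by split; [exact: strict_wf|exact: (strict_trans wo)|exact: strict_total].
Qed.

(* An initial segment whose order type is the successor cardinal of [L]. *)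
Let small : set X := [set x | init_segment lt x #<= [set: L]].

Let before (x : X) : set Phi := [set u | forall k, ~ lt k x -> u k = 0].

Let small_down x y : small y -> lt x y -> small x.
Proof.
move=> yL xy; apply: card_le_trans yL; apply: subset_card_le => z zx.
exact: (strict_trans wo zx xy).
Qed.

Let Xinf : infinite_set [set: X].
Proof. by apply/infiniteP; apply: card_le_trans (card_nat_le Linf) LX. Qed.

Let FL : [set: F] #<= [set: L]. Proof. exact: card_le_free. Qed.

(** Otherwise [XL] gives a least index outside [small]; its initial segment lies in [small], so it
    would have size at most [L], making the index small. *)
Let small_big : [set: L] #<= small.
Proof.
have [//|sL] := card_le_total [set: L] small; exfalso.
have [x nsx xm] : exists2 x, ~ small x & forall y, lt y x -> ~ ~ small y.
  apply: (wto_least ltO (P := ~` small)); apply: contrapT => N; apply: XL.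
  apply: card_le_trans sL; apply: subset_card_le => x _.
  by apply: contrapT => nx; apply: N; exists x.
apply: nsx; apply: card_le_trans sL; apply: subset_card_le => y yx.
by apply: contrapT; apply: xm.
Qed.

(* [x] is chosen so that the isomorphism of the amalgam with a direct sum of
   copies of [C] carries the stage [x] into a sub-sum [B] which comes back into
   the stage [x]; the retraction is then the projection onto [B]. *)
Lemma amalgam_retract (G : X -> set Phi -> F -> Phi) (Rel : X -> set Phi)
  (Gatt : forall x S, S 0 -> attaching lt x S (G x S))
  (Gout : forall x S, ~ small x -> forall k, S 0 -> G x S k = 0)
  (RelE : forall x, Rel x = [set w | exists2 k, free_relations k &
     below Rel (init_segment lt x) (w - (at_ x k - G x (below Rel (init_segment lt x)) k))]) :
  exists x (r : {linear amalgam ltO Gatt RelE -> amalgam ltO Gatt RelE}),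
    [/\ small x, [set: L] #<= init_segment lt x,
      forall l, below (@stage _ _ _ _ ltO _ Gatt _ RelE) (init_segment lt x) (r l) &
      forall l, below (@stage _ _ _ _ ltO _ Gatt _ RelE) (init_segment lt x) l -> r l = l].
Proof.
set Lm := amalgam ltO Gatt RelE; pose pr := amalgam_proj ltO Gatt RelE.
pose T := @stage _ _ _ _ ltO _ Gatt _ RelE.
have stageP l := @below_stage _ _ _ _ ltO _ Gatt _ RelE _ l small_down.
have [g ch] := amalgam_chain ltO Gatt RelE.
have LmX : [set: Lm] #= [set: X].
  rewrite card_eq_le; apply/andP; split; last exact: (chain_card ch).
  apply: (@card_le_trans _ _ _ [set: Phi]).
    by apply: (@card_le_surj _ _ pr) => l _; have [u e] := amalgam_projP l; exists u.
  apply: card_le_dsum => // _; exact: card_le_trans FL LX.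
have QX : [set: dsum (fun _ : X => C)] #= [set: X].
  rewrite card_eq_le; apply/andP; split.
    apply: card_le_dsum => // _; exact: card_le_trans CL LX.
  exact: (chain_card (dsum_chain (fun _ : X => C) ltO)).
have [f [f' [fK f'K]]] := bij_linear_inverse
  (cat_X ch (dsum_chain (fun _ : X => C) ltO) LmX QX).
pose cutS (u : Phi) : Phi := dsum_cut small u.
(* Steps outside [small] attach by zero, so cutting to the small copies respects the relations. This
   induces the retraction [rho] onto the union of the small stages. *)
have cutR x w : Rel x w -> below Rel setT (cutS w).
  have Tsub := relations_below_submodule ltO Gatt RelE setT.
  elim/(wto_ind ltO): x w => x IH w xw.
  have [sx|nsx] := pselect (small x).
    right; exists x => //; rewrite [cutS w]cut_id// => i nsi.
    have [_ _ h _ _] := Rel_invariant ltO Gatt RelE x.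
    apply: (h _ xw); have [e|//|ix] := wto_total ltO x i; first by rewrite e in sx.
    by case: nsi; apply: small_down ix.
  move: xw; rewrite RelE => -[k kr].
  rewrite Gout//; last by left.
  rewrite subr0 => xs.
  have -> : cutS w = cutS (w - at_ x k).
    apply: dsum_ext => i; have [si|nsi] := pselect (small i).
      rewrite ![cutS _ i]cut_in// !coordE single0 ?oppr0 ?addr0// => e.
      by rewrite e in si.
    by rewrite ![cutS _ i]cut_out.
  case: xs => [->|[y yx yw]]; last exact: IH yx _ yw.
  by left; rewrite [cutS 0](linear0 (linear_of (cut_linear _))).
have [rho rhoE] : exists rho : {linear Lm -> Lm}, forall u, rho (pr u) = pr (cutS u).
  have rE u : pr (cutS (quotient_repr (pr u))) = pr (cutS u).
    apply/(amalgam_proj_eq ltO Gatt RelE); pose cl := linear_of (@cut_linear A X (fun=> F) small).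
    rewrite -[cutS _]/(cl _) -[cutS u]/(cl u) -linearB.
    have : below Rel setT (quotient_repr (pr u) - u).
      by apply/(amalgam_proj_eq ltO Gatt RelE); apply: quotient_reprK.
    by move=> [->|[x _ xw]]; [left; rewrite linear0|apply: cutR xw].
  have rL : linear (fun l : Lm => pr (cutS (quotient_repr l))).
    move=> a u v; have [u' <-] := amalgam_projP u; have [v' <-] := amalgam_projP v.
    by rewrite -linearP !rE -linearP; congr (pr _); apply: cut_linear.
  by exists (linear_of rL) => u; rewrite linear_ofE rE.
have rho_id l : below T small l -> rho l = l.
  by move=> /stageP[u us <-]; rewrite rhoE [cutS u]cut_id.
have rho_small l : below T small (rho l).
  have [u <-] := amalgam_projP l; rewrite rhoE.
  apply/stageP; exists (cutS u) => // k nk.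
  exact: cut_out.
have /choice[zeta zetaP] : forall l, exists z, below T small l -> l <> 0 -> small z /\ T z l.
  move=> l; have [[l0|[z sz zl]]|N] := pselect (below T small l).
  - have [x _] := infinite_setN0 Xinf; exists x => _; case.
    exact: l0.
  - by exists z.
  - have [x _] := infinite_setN0 Xinf; exists x => /N[].
(* The element [c] of the summand [t], carried back to the amalgam and retracted to the small
   stages; [zeta] gives the index of a stage containing it if it is nonzero. *)
pose q t c : Lm := rho (f' (dsum_single (fun _ : X => C) t c)).
have qP t c : q t c <> 0 -> small (zeta (q t c)) /\ T (zeta (q t c)) (q t c).
  by apply: zetaP; apply: rho_small.
have TL x : small x -> T x #<= [set: L].
  move=> sx; pose B := init_segment lt x `|` [set x].
  have BL : B #<= [set: L].
    have -> : B = \bigcup_(b in [set: bool]) if b then init_segment lt x else [set x].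
      apply/seteqP; split=> y; first by move=> [?|?]; [exists true|exists false].
      by move=> [[] _ ?]; [left|right].
    apply: card_le_bigcup => // [|[] _].
    - exact: card_le_trans (countableP _) (card_nat_le Linf).
    - exact: sx.
    - by apply: card_le_trans (card_nat_le Linf); apply: countable1.
  have : [set: dsum (fun _ : down_type B => F)] #<= [set: L].
    by apply: card_le_dsum => //; apply: card_le_trans (card_down_type B) BL.
  apply: card_le_trans.
  apply: (@card_le_surj _ _ (fun w => pr (dsum_extend (fun=> F) B w)) setT) => _ [u xu <-].
  exists (dsum_restrict (fun=> F) B u) => //; congr (pr _); apply: cut_id => i nB.
  apply: xu; have [e|//|ix] := wto_total ltO x i; case: nB; first by right.
  by left.
(* For every summand [t] met by the image of stage [x], all of that copy of [C] has to come back,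
   hence the union over every [c]. *)
pose next x : set X := \bigcup_(l in T x) \bigcup_(t in [set t | t \in supp_seq (f l)])
  (fun c => zeta (q t c)) @` [set c | q t c <> 0].
have nextP x : small x -> next x `<=` small /\ next x #<= [set: L].
  move=> sx; split=> [_ [l _ [t _ [c qc <-]]]|]; first by case: (qP t c qc).
  apply: card_le_bigcup => // [|l _]; first exact: TL.
  apply: card_le_bigcup => // [|t _].
    apply: card_le_trans (card_nat_le Linf).
    by apply: finite_set_countable; apply: finite_seq.
  apply: card_le_trans (card_image_le _ _) (card_le_trans (card_leT _) CL).
have [x0 _] := infinite_setN0 Xinf.
(* Starting the closure from [L] many indices ensures that the stage found is not smaller than
   [L]. *)
have [i0 i0s i0I] := card_le_injfun x0 small_big.
have D0L : range i0 #<= [set: L] by apply: card_image_le.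
have D0s : range i0 `<=` small by move=> _ [y _ <-]; apply: i0s.
have [Z [D0Z Zs ZL Zn]] := small_closure Linf D0L D0s nextP.
(* The down-closure of [Z] is the initial segment of the least index [x] outside it. Stages
   increase, so the new indices contribute no elements and no further closing is needed. *)
pose Zd : set X := \bigcup_(z in Z) (init_segment lt z `|` [set z]).
have ZdL : Zd #<= [set: L].
  apply: card_le_trans (_ : Zd #<= \bigcup_(b in [set: bool])
    if b then \bigcup_(z in Z) (if `[<small z>] then init_segment lt z else set0) else Z) _.
    apply: subset_card_le => y [z Zz [yz|->]]; last by exists false.
    by exists true => //; exists z => //; rewrite asboolT//; apply: Zs.
  apply: card_le_bigcup => // [|[] _ //].
    exact: card_le_trans (countableP _) (card_nat_le Linf).
  apply: card_le_bigcup => // z _; case: asboolP => [sz|_]; first exact: sz.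
  exact: card_ge0.
have Zddown y z : Zd z -> lt y z -> Zd y.
  move=> [t Zt [zt|->]] yz; exists t => //; left => //.
  exact: (strict_trans wo yz zt).
have [x nx xm] : exists2 x, ~ Zd x & forall y, lt y x -> ~ ~ Zd y.
  apply: (wto_least ltO (P := ~` Zd)); apply: contrapT => N; apply: XL.
  apply: card_le_trans ZdL; apply: subset_card_le => y _.
  by apply: contrapT => ny; apply: N; exists y.
have segE : init_segment lt x = Zd.
  apply/seteqP; split=> y; first by move=> yx; apply: contrapT; apply: xm.
  move=> Zy; have [e|//|xy] := wto_total ltO y x; first by rewrite e in Zy.
  by case: nx; apply: Zddown xy.
have sx : small x by rewrite /small /= segE.
have segs y : init_segment lt x y -> small y by move=> yx; apply: small_down yx.
pose B : set X := [set t | exists l, below T (init_segment lt x) l /\ f l t <> 0].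
pose cutB := linear_of (@cut_linear A X (fun=> C) B).
have rL : linear (fun l : Lm => rho (f' (cutB (f l)))) by move=> a u v; rewrite !linearP.
have Ssub := below_submodule ch (init_segment lt x).
have Zseg z : Z z -> init_segment lt x z by rewrite segE => Zz; exists z => //; right.
exists x, (linear_of rL); split=> //.
- apply: (@card_le_trans _ _ _ (range i0)); last first.
    by apply: subset_card_le => y /D0Z/Zseg.
  have : range i0 #= [set: L] by apply: inj_card_eq.
  by rewrite card_eq_sym card_eq_le => /andP[].
- move=> l; rewrite linear_ofE [cutB _]dsum_single_sum !linear_sum.
  apply: is_submodule_sum => // t; have [tB|tB] := pselect (B t); last first.
    by rewrite [cutB _ _]cut_out// !linear0; left.
  set c := cutB _ _; rewrite -[rho _]/(q t c).
  have [q0|q0] := pselect (q t c = 0); first by left.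
  have [_ Tz] := qP t c q0; right; exists (zeta (q t c)) => //; apply: Zseg.
  have [m [[m0|[y yx ym]] mt]] := tB; first by case: mt; rewrite m0 linear0.
  have [z Zz zm] : exists2 z, Z z & T z m.
    move: yx; rewrite segE => -[z Zz [yz|e]]; exists z => //.
      exact: (chain_mono ch yz).
    by rewrite -e.
  apply: (Zn z Zz); exists m => //; exists t; last by exists c.
  by apply: contrapT => /negP/supp_seqP.
- move=> l Sl; rewrite linear_ofE [cutB _]cut_id; last first.
    by move=> t nB; apply: contrapT => lt0; apply: nB; exists l.
  rewrite fK; apply: rho_id; case: Sl => [->|[y /segs sy yl]]; first by left.
  by right; exists y.
Qed.

(** The step attached by [g] splits: modulo the earlier relations [S], the map [g] extends linearly
    from the relations of [C] to the free module. *)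
Definition extendable x (S : set (dsum (fun _ : X => free_module C)))
    (g : F -> dsum (fun _ : X => free_module C)) : Prop :=
  exists e : F -> Phi, [/\ forall u, before x (e u),
    forall a u v, S (e (a *: u + v) - (a *: e u + e v)) &
    forall k, free_relations k -> S (e k - g k)].

Lemma ext_vanish_categorical : ext_vanish C P.
Proof.
move=> f fr; apply: contrapT => noext.
have before_sub x : is_submodule (before x).
  by split=> [//|a u v xu xv k xk]; rewrite !coordE xu// xv// scaler0 addr0.
(* The choice looks only at [x] and the relations so far, never at [P] or [f]: a non-split step at
   small [x] whenever possible, a split one beyond. *)
have /choice[G' GP] : forall p : X * set Phi, exists g : F -> Phi, p.2 0 ->
    [/\ attaching lt p.1 p.2 g,
      small p.1 -> (exists2 g', attaching lt p.1 p.2 g' & ~ extendable p.1 p.2 g') ->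
        ~ extendable p.1 p.2 g &
      ~ small p.1 -> forall k, g k = 0].
  move=> [x S] /=.
  have att0 : S 0 -> attaching lt x S (fun=> 0).
    move=> S0; split=> [k _|a u v _ _]; first by case: (before_sub x).
    by rewrite scaler0 addr0 subrr.
  have [[sx [g' ga gn]]|N] := pselect (small x /\
      exists2 g', attaching lt x S g' & ~ extendable x S g').
    by exists g' => _; split=> // nsx; case: nsx.
  exists (fun=> 0) => S0; split=> //; first exact: att0.
  by move=> sx gx; case: N.
pose G x S := G' (x, S).
have Gatt x S : S 0 -> attaching lt x S (G x S) by move=> /(GP (x, S))[].
have Gout x S : ~ small x -> forall k, S 0 -> G x S k = 0.
  by move=> nsx k /(GP (x, S))[_ _ h]; apply: h.
have [Rel RelE] := wf_family (fun x (S : set Phi) =>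
  [set w | exists2 k, free_relations k & S (w - (at_ x k - G x S k))]) (strict_wf wo).
have [x [r [sx Lx rS rid]]] := amalgam_retract Gatt Gout RelE.
pose Lm := amalgam ltO Gatt RelE; pose pr := amalgam_proj ltO Gatt RelE.
pose T := @stage _ _ _ _ ltO _ Gatt _ RelE.
have stageP l : below T (init_segment lt x) l <-> exists2 u, before x u & pr u = l.
  by apply: below_stage => y z; apply: segment_down.
have [g ch] := amalgam_chain ltO Gatt RelE.
pose S := below Rel (init_segment lt x).
have Ssub := below_submodule ch (init_segment lt x).
(* The stage before [x] as a module: it is filtered by copies of [C] and has size [L], hence is
   isomorphic to [P]. *)
pose P' : lmodType A := submodule (set_pred Ssub).
pose val' : {linear P' -> Lm} := linear_of (f := fun p : P' => \val p) (fun a u v => linearP _ _ _ _).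
have val'P p : below T (init_segment lt x) (val' p) by apply/asboolP; apply: (valP p).
have mkP l : below T (init_segment lt x) l -> exists p, val' p = l.
  by move=> /asboolP Sl; exists (Submodule (Sl : l \in set_pred Ssub)).
have val'I : injective val' by move=> p p' e; apply: val_inj.
have ch' := chain_restrict ch (Z := init_segment lt x) (f := val')
  (fun y z => @segment_down _ _ ltO y z x) val'I
  (fun l => conj (@mkP l) (fun h => let: ex_intro p e := h in eq_ind _ _ (val'P p) _ e)).
have P'L : [set: P'] #= [set: L].
  rewrite card_eq_le; apply/andP; split; last first.
    refine (card_le_trans _ (chain_card ch' (fun=> Cn0))).
    apply: (card_le_trans Lx).
    by apply: (@card_le_surj _ _ val setT) => y yx; exists (down_elt yx).
  have : [set: dsum (fun _ : down_type (init_segment lt x) => F)] #<= [set: L].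
    by apply: card_le_dsum => //; apply: card_le_trans (card_down_type _) sx.
  apply: card_le_trans.
  have /choice[w wP] : forall p : P', exists w, pr (dsum_extend (fun=> F) (init_segment lt x) w) = val' p.
    move=> p; have /stageP[u bu e] := val'P p.
    exists (dsum_restrict (fun=> F) (init_segment lt x) u); rewrite -e; congr (pr _).
    exact: cut_id.
  by apply/card_leTP; exists w => p p' e; apply: val'I; rewrite -!wP e.
have [al [be [alK beK]]] := bij_linear_inverse (cat_L ch' P'L).
have prS u : before x u -> pr u = 0 -> S u.
  by move=> bu /amalgam_proj_eq0 u0; apply: (Tot_before ltO Gatt RelE).
(* The map [f] transported to this stage; choosing representatives keeps it linear only modulo
   [S]. *)
have /choice[g' g'P] : forall k, exists u, before x u /\ pr u = val' (be (f k)).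
  by move=> k; have /stageP[u bu e] := val'P (be (f k)); exists u.
have att' : attaching lt x S g'.
  split=> [k _|a u v ur vr]; first by case: (g'P k).
  apply: prS.
    apply: (is_submoduleB (before_sub x)); first by case: (g'P (a *: u + v)).
    by have [_ h] := before_sub x; apply: h; [case: (g'P u)|case: (g'P v)].
  rewrite linearB linearP (g'P _).2 (g'P u).2 (g'P v).2 fr//.
  by rewrite (linearP be) (linearP val') subrr.
have next' : ~ extendable x S g'.
  move=> [e [eb el ek]]; apply: noext.
  have /choice[e' e'P] : forall u, exists p, val' p = pr (e u).
    by move=> u; apply/mkP/stageP; exists (e u).
  have prel u : S u -> pr u = 0.
    move=> [->|[y _ yu]]; first exact: linear0.
    by apply/amalgam_proj_eq0; right; exists y.
  have e'L : linear e'.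
    move=> a u v; apply: val'I; rewrite linearP !e'P -linearP.
    by apply/eqP; rewrite -subr_eq0 -linearB; apply/eqP/prel.
  exists (linear_of (f := fun u => al (e' u))
    (fun a u v => etrans (congr1 al (e'L a u v)) (linearP al a (e' u) (e' v)))).
  move=> k kr; rewrite linear_ofE -[RHS]beK; congr (al _); apply: val'I.
  rewrite e'P -(g'P k).2; apply/eqP; rewrite -subr_eq0 -linearB; apply/eqP/prel.
  exact: ek.
have S0 : S 0 by left.
have [_ /(_ sx) h _] := GP (x, S) S0.
apply: h; first by exists g'.
(* In the amalgam a relation [k] in the copy at [x] equals [G x S k], which [r] fixes. So [r]
   applied to this copy extends the attaching map, contradicting its choice. *)
have /choice[e eP] : forall u, exists w, before x w /\ pr w = r (pr (at_ x u)).
  by move=> u; have /stageP[w bw e] := rS (pr (at_ x u)); exists w.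
exists e; split=> [u|a u v|k kr]; first by case: (eP u).
  apply: prS.
    apply: (is_submoduleB (before_sub x)); first by case: (eP (a *: u + v)).
    by have [_ h] := before_sub x; apply: h; [case: (eP u)|case: (eP v)].
  by rewrite linearB linearP (eP _).2 (eP u).2 (eP v).2 (linearP (at_ x)) (linearP pr) (linearP r) subrr.
have [Gb _] := Gatt x S S0.
apply: prS; first by apply: (is_submoduleB (before_sub x)); [case: (eP k)|exact: Gb].
rewrite linearB (eP k).2.
have -> : pr (at_ x k) = pr (G x S k).
  by apply/amalgam_proj_eq; apply: (attaching_relation RelE).
rewrite rid ?subrr//; apply/stageP; exists (G x S k) => //.
exact: Gb.
Qed.

End KeyLemma.

(** * Categoricity in a tail *)

Lemma card_eqTP (T U : Type) : [set: T] #= [set: U] -> exists f : T -> U, bijective f.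
Proof.
elim/Ppointed: U => U.
  rewrite (_ : [set: U] = set0); last by apply/seteqP; split=> // x; case: (no x).
  rewrite card_eq0 => /eqP T0.
  have noT (x : T) : False by have : [set: T] x by []; rewrite T0.
  by exists (fun x => False_rect _ (noT x)); exists (fun x => False_rect _ (no x)) => x;
    [case: (noT x)|case: (no x)].
by move=> /card_set_bijP[f fb]; exists f; rewrite -setTT_bijective.
Qed.

Lemma card_eq_anti (T U : Type) (A : set T) (B : set U) :
  A #<= B -> B #<= A -> A #= B.
Proof. by move=> AB BA; rewrite card_eq_le AB BA. Qed.

Lemma card_ltN (T U : Type) (A : set T) (B : set U) : card_lt A B -> ~ (B #<= A).
Proof. by move=> [AB nAB] BA; move/negP: nAB; apply; apply: card_eq_anti. Qed.

(** Cantor's diagonal set: the codes of sets that do not contain their own code. *)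
Lemma card_powerset (T : Type) : ~ ([set: set T] #<= [set: T]).
Proof.
move=> /card_leTP[f fI]; pose D : set T := [set t | exists S, f S = t /\ ~ S t].
have [Df|nDf] := pselect (D (f D)); last by apply: (nDf); exists D; split.
by have [S [/fI -> nD]] := Df.
Qed.

Lemma isomorphic_card (A : pzRingType) (M N : lmodType A) :
  isomorphic M N -> [set: M] #= [set: N].
Proof.
move=> [f [g fK gK]]; apply: card_eq_anti; apply/card_leTP.
  by exists f; apply: can_inj fK.
by exists g; apply: can_inj gK.
Qed.

Section Deconstructible.
Variables (A : pzRingType) (J : choiceType) (C : J -> lmodType A).
Notation D := (Filt (from_family C)).

Lemma Filt_dsum (I : choiceType) (i : I -> J) : D (dsum (fun x => C (i x))).
Proof.
have [le wo] := well_ordering_principle I.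
have ltO : wf_total_order (strictly le).
  by split; [exact: strict_wf|exact: (strict_trans wo)|exact: strict_total].
exact: (chain_Filt (j := i) (dsum_chain (fun x => C (i x)) ltO)).
Qed.

Lemma card_ge_dsum (I : choiceType) (N : I -> lmodType A) (T : Type) (f : T -> I) :
  injective f -> (forall t, exists c : N (f t), c <> 0) ->
  [set: T] #<= [set: dsum N].
Proof.
move=> fI /dependent_choice[c c0]; apply/card_leTP.
exists (fun t => dsum_single N (f t) (c t)) => t t' e; apply: fI; apply: contrapT => ft.
by apply: (c0 t); rewrite -(singleE (c t)) e single0.
Qed.

Section Categorical.
Variables L X : choiceType.
Hypothesis Linf : infinite_set [set: L].
Hypothesis LX : [set: L] #<= [set: X].
Hypothesis XL : ~ ([set: X] #<= [set: L]).
Hypothesis AL : [set: A] #<= [set: L].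
Hypothesis CL : forall j, [set: C j] #<= [set: L].
Hypothesis cat_L : categorical L D.
Hypothesis cat_X : categorical X D.

(** Adding [L] copies of [C j] brings the sum to size exactly [L], where categoricity applies, and
    keeps the given sum as a retract. *)
Lemma ext_vanish_small j (I : choiceType) (i : I -> J) :
  [set: I] #<= [set: L] -> ext_vanish (C j) (dsum (fun x => C (i x))).
Proof.
move=> IL; have [[c c0]|C0] := pselect (exists c : C j, c <> 0); last first.
  (* If [C j] is zero, everything is a relation and [f] is already linear. *)
  have all_rel u : free_relations (C := C j) u by apply: contrapT => u0; apply: C0; exists (free_lift id u).
  move=> f fr; have fL : linear f by move=> a u v; apply: fr.
  by exists (linear_of fL).
pose ij (x : I + L) := if x is inl y then i y else j.
pose Q := dsum (fun x => C (ij x)).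
have QL : [set: Q] #= [set: L].
  apply: card_eq_anti; first by apply: card_le_dsum => //; apply: card_le_sum.
  by apply: (@card_ge_dsum _ _ _ inr) => [x y []|l] //; exists c.
have inlI : injective (@inl I L) by move=> x y [].
apply: (ext_vanish_retract (pushK (N := fun x => C (ij x)) inlI)).
have [le wo] := well_ordering_principle X.
apply: (ext_vanish_categorical wo Linf LX XL AL (CL j)); first by exists c.
  move=> M Y ltY T g ch ML; apply: cat_L.2 => //; last exact: Filt_dsum.
  exact: (chain_Filt (j := fun=> j) ch).
move=> M M' Y Y' ltY ltY' T g T' g' ch ch'; apply: cat_X.2.
  exact: (chain_Filt (j := fun=> j) ch).
exact: (chain_Filt (j := fun=> j) ch').
Qed.

Lemma Filt_decomposition M : D M -> exists (I : choiceType) (i : I -> J),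
  (forall x, exists c : C (i x), c <> 0) /\ isomorphic M (dsum (fun x => C (i x))).
Proof.
move=> /Filt_chain[Y [lt [j [T [g [n0 ch]]]]]].
exists (down_type [set: Y]), (fun x => j (val x)); split=> [x|]; first exact: n0.
apply: isomorphic_sym; apply: chain_split ch => j' I i.
exact: (ext_vanish_dsum Linf AL (CL j') (@ext_vanish_small j')).
Qed.

Lemma nontrivial_index : exists j, exists c : C j, c <> 0.
Proof.
have [[M [DM ML]] _] := cat_L.
have [I [i [n0 [f fb]]]] := Filt_decomposition DM.
have [[x _]|N] := pselect (exists x : I, True); first by exists (i x).
exfalso; apply: Linf; rewrite -(eq_finite_set ML).
have M0 (m : M) : m = 0.
  apply: (bij_inj fb); apply: dsum_ext => x; case: N; by exists x.
by apply: sub_finite_set (finite_set1 (0 : M)) => m _; apply: M0.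
Qed.

(** The target depends on [L'] and not on [M], so any two members of that size are isomorphic
    through it. *)
Lemma Filt_power j0 (L' : choiceType) M : (exists c : C j0, c <> 0) ->
  [set: X] #<= [set: L'] -> D M -> [set: M] #= [set: L'] ->
  isomorphic M (dsum (fun _ : L' => dsum (fun _ : L => C j0))).
Proof.
move=> j0n XL' DM ML'; set P0 : lmodType A := dsum (fun _ : L => C j0).
have [I [i [n0 iso]]] := Filt_decomposition DM.
apply: (isomorphic_trans iso); set N := dsum _ in iso *.
have NL' : [set: N] #= [set: L'].
  by rewrite -(card_eql (isomorphic_card iso)).
have /andP[NleL' L'leN] : ([set: N] #<= [set: L']) && ([set: L'] #<= [set: N]).
  by rewrite -card_eq_le.
(* A sum of at most [L] summands would have size at most [L], below [X]. With at least [L] nonzero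
   summands, the sum and its index set have the same size. *)
have LI : [set: L] #<= [set: I].
  have [IL|//] := card_le_total [set: I] [set: L]; exfalso; apply: XL.
  by apply: card_le_trans XL' (card_le_trans L'leN _); apply: card_le_dsum.
have Iinf : infinite_set [set: I].
  by apply/infiniteP; apply: card_le_trans (card_nat_le Linf) LI.
have IN : [set: I] #<= [set: N] by apply: (@card_ge_dsum _ _ _ id).
have NI : [set: N] #<= [set: I].
  by apply: card_le_dsum => // x; apply: card_le_trans (CL _) LI.
have LL' : [set: L] #<= [set: L'] := card_le_trans LX XL'.
have L'inf : infinite_set [set: L'].
  by apply/infiniteP; apply: card_le_trans (card_nat_le Linf) LL'.
have [e [e' eK e'K]] : exists e : L' * L -> I, bijective e.
  apply: card_eqTP; apply: card_eq_anti.
    apply: card_le_trans (card_le_trans L'leN NI).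
    apply: card_le_trans (card_le_square L'inf).
    have [h hI] := (card_leTP _ _).1 LL'; apply/card_leTP.
    by exists (fun p => (p.1, h p.2)) => -[t s] [t' s'] /= [-> /hI ->].
  apply: card_le_trans IN (card_le_trans NleL' _).
  have [l0 _] := infinite_setN0 Linf.
  by apply/card_leTP; exists (fun t => (t, l0)) => t t' [].
have eI t : injective (fun s => e (t, s)) by move=> s s' /(can_inj eK)[].
have P0L : [set: P0] #= [set: L].
  by apply: card_eq_anti; [apply: card_le_dsum|apply: (@card_ge_dsum _ _ _ id)].
have blockL t : [set: dsum (fun s : L => C (i (e (t, s))))] #= [set: L].
  by apply: card_eq_anti; [apply: card_le_dsum|apply: (@card_ge_dsum _ _ _ id)].
have /dependent_choice[th thb] : forall t,
    exists f : {linear dsum (fun s : L => C (i (e (t, s)))) -> P0}, bijective f.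
  move=> t; apply: (cat_L.2 _ _ _ _ (blockL t) P0L).
    exact: (Filt_dsum (fun s => i (e (t, s)))).
  exact: (Filt_dsum (fun=> j0)).
pose block t : {linear N -> dsum (fun s : L => C (i (e (t, s))))} :=
  dsum_pull (fun x => C (i x)) (eI t).
have fin (u : N) : exists s : seq L', forall t, t \notin s -> th t (block t u) = 0.
  exists [seq (e' x).1 | x <- supp_seq u] => t ts.
  have -> : block t u = 0; last exact: linear0.
  apply: dsum_ext => s; apply: contrapT => us; move/negP: ts; apply.
  apply/mapP; exists (e (t, s)); last by rewrite eK.
  by apply: contrapT => /negP/supp_seqP.
pose psi (u : N) : dsum (fun _ : L' => P0) := Dsum (fin u).
have psiL : linear psi.
  move=> a u v; apply: dsum_ext => t; rewrite !coordE.
  by rewrite -[LHS]/(th t (block t (a *: u + v))) (linearP (block t)) (linearP (th t)).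
apply: (@inj_surj_isomorphic _ _ _ (linear_of psiL)) => [u v uv|w].
  apply: dsum_ext => x; rewrite -(e'K x); case: (e' x) => t s.
  have /(bij_inj (thb t)) b : th t (block t u) = th t (block t v).
    by rewrite -[LHS]/(psi u t) -[RHS]/(psi v t); congr (dsum_fun _ t).
  by rewrite -[LHS]/(block t u s) b.
have /choice[v vP] : forall p : L' * P0, exists u,
    linear_of psiL u = dsum_single (fun=> P0) p.1 p.2.
  move=> [t q] /=; have [th' _ th'K] := thb t.
  exists (dsum_push (fun x => C (i x)) (fun s => e (t, s)) (th' q)).
  apply: dsum_ext => t'; rewrite -[LHS]/(th t' (block t' _)).
  have [->|/eqP tt'] := eqVneq t' t; first by rewrite singleE [block _ _]pushK.
  rewrite single0//; have -> : block t' (dsum_push (fun x => C (i x)) (fun s => e (t, s)) (th' q)) = 0.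
    apply: dsum_ext => s'; apply: push_out => s /(can_inj eK)[tt _].
    by apply: tt'.
  exact: linear0.
exists (\sum_(t <- supp_seq w) v (t, w t)).
by rewrite linear_sum [RHS]dsum_single_sum; apply: eq_bigr => t _; rewrite vP.
Qed.

Lemma categorical_above (L' : choiceType) :
  [set: X] #<= [set: L'] -> categorical L' D.
Proof.
move=> XL'; have [j0 j0n] := nontrivial_index.
have LL' : [set: L] #<= [set: L'] := card_le_trans LX XL'.
have L'inf : infinite_set [set: L'].
  by apply/infiniteP; apply: card_le_trans (card_nat_le Linf) LL'.
split.
  exists (dsum (fun _ : L' => C j0)); split; first exact: (Filt_dsum (fun=> j0)).
  apply: card_eq_anti; last exact: (@card_ge_dsum _ _ _ id).
  by apply: card_le_dsum => // _; apply: card_le_trans (CL j0) LL'.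
move=> M N DM DN ML' NL'; apply: isomorphic_trans (Filt_power j0n XL' DM ML') _.
exact: isomorphic_sym (Filt_power j0n XL' DN NL').
Qed.

End Categorical.

End Deconstructible.

Theorem theorem2p12 (R : pzRingType) (D : rmodType R -> Prop)
    (D_deconstructible : deconstructible D) :
  ((exists theta : choiceType, forall lambda : choiceType,
      card_lt [set: theta]%classic [set: lambda]%classic ->
      ~ categorical lambda D) \/
   (exists theta' : choiceType, forall lambda : choiceType,
      ([set: theta']%classic #<= [set: lambda]%classic)%card ->
      categorical lambda D)) /\
  (exists mu : choiceType, forall lambda : choiceType,
      card_lt [set: mu]%classic [set: lambda]%classic ->
      (categorical lambda D <->
       exists theta' : choiceType, forall lambda' : choiceType,
         ([set: theta']%classic #<= [set: lambda']%classic)%card ->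
         categorical lambda' D)).
Proof.
have [kappa [_ [J [C [_ _ DE]]]]] := D_deconstructible.
have {DE}-> : D = Filt (from_family C) by apply/funext => M; apply/propext/DE.
set P1 := exists theta, _; set P2 := exists theta', _.
have alternative : P1 \/ P2.
  have [|N] := pselect P1; [by left|right].
  have large (theta : choiceType) : exists lambda : choiceType,
      card_lt [set: theta] [set: lambda] /\ categorical lambda (Filt (from_family C)).
    apply: contrapT => h; apply: N; exists theta => lambda lt cat.
    by apply: h; exists lambda.
  (* A single bound makes [L] infinite and at least as large as the ring and every member of the
     family. *)
  have [L [[BL _] catL]] := large (nat + (R^c + {j : J & C j}))%type.
  have [X [LX catX]] := large L.
  exists X => lambda; apply: (@categorical_above _ _ C L X) => //.
  - by apply/infiniteP; apply: card_le_trans BL; apply/card_leTP; exists inl => x y [].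
  - by case: LX.
  - exact: card_ltN LX.
  - by apply: card_le_trans BL; apply/card_leTP; exists (inr \o inl) => x y [].
  - move=> j; apply: card_le_trans BL; apply/card_leTP.
    exists (fun c => inr (inr (existT (fun j => C j : Type) j c))) => x y.
    (* The value on the other summands is a mere default. *)
    move=> /(congr1 (fun z => if z is inr (inr p) then p else existT _ j x)) /= e.
    by have := projT2_eq e; rewrite (Prop_irrelevance (projT1_eq e) erefl).
split=> //; case: alternative => [[theta no]|[theta' yes]].
  exists theta => lambda /no nocat; split=> // -[theta' cat]; exfalso.
  (* A cardinal strictly above [theta] and at least [theta'], where the two assumptions clash. *)
  pose U : choiceType := set (theta + theta').
  have UN : [set: U] #<= [set: theta + theta'] -> False := @card_powerset _.
  have thU : [set: theta + theta'] #<= [set: U].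
    by apply/card_leTP; exists (fun x => [set x]) => x y /seteqP[h _]; exact: (h x erefl).
  have thl : [set: theta] #<= [set: theta + theta'].
    by apply/card_leTP; exists inl => x y [].
  have thr : [set: theta'] #<= [set: theta + theta'].
    by apply/card_leTP; exists inr => x y [].
  apply: (no U); last by apply: cat; apply: card_le_trans thr thU.
  split; first exact: card_le_trans thl thU.
  apply/negP => e; apply: UN; apply: card_le_trans thl.
  by move: e; rewrite card_eq_le => /andP[].
exists theta' => lambda [le _]; split=> _; first by exists theta'.
exact: yes.
Qed.
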